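(* Assume that $\{P_t\}_{t\ge0}$ satisfies the weak Bakry-Émery condition ${\rm wBE}(\kappa_1,\kappa_2)$ with $0<\kappa_i<\beta_i$, $i=1,2$. Let $1\le p\le2$ and $$\Psi_p(t)=\sigma_{(1-\frac2p)\frac{\kappa_1}{\beta_1}+\frac1p,\,(1-\frac2p)\frac{\kappa_2}{\beta_2}+\frac1p}(t).$$ Then there exists $C>0$ such that for every $f\in\mathbf{B}^{p,\Psi_p}(X)$ and every $t\ge0$ $$\|P_tf-f\|_{L^p(X,\mu)}\le C\,\Psi_p(t)\,\liminf_{\tau\to0^+}\frac1{\tau^{(1-\frac2p)\frac{\kappa_1}{\beta_1}+\frac1p}}\left(\int_XP_\tau(|f-f(y)|^p)(y)\,d\mu(y)\right)^{1/p}.$$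
   Context: Notation: for $\alpha,\beta>0$, $\sigma_{\alpha,\beta}(x):=x^\alpha1_{[0,1]}(x)+x^\beta1_{(1,+\infty)}(x)$, $x\ge0$. Setting: $(X,d)$ is a locally compact complete metric space with open balls $B(x,r)=\{y:d(x,y)<r\}$, $\mu$ is a Radon measure, doubling and positive: there is $C>0$ with $0<\mu(B(x,2r))\le C\mu(B(x,r))<\infty$ for all $x\in X,r>0$. $(\mathcal E,\mathcal F)$ is a Dirichlet form on $L^2(X,\mu)$ with heat semigroup $\{P_t\}_{t\ge0}$, which is conservative ($P_t1=1$). Volume assumption: there are $\alpha_1,\alpha_2\ge1$ and $C>0$ with $C^{-1}\sigma_{\alpha_1,\alpha_2}(r)\le\mu(B(x,r))\le C\sigma_{\alpha_1,\alpha_2}(r)$ for all $x\in X,r>0$. Heat kernel assumption: $\{P_t\}$ has a heat kernel $p_t(x,y)$ (i.e. $P_tf(x)=\int_Xp_t(x,y)f(y)\,d\mu(y)$) and there are $\beta_1,\beta_2$ with $2\le\beta_i\le1+\alpha_i$ ($i=1,2$) such that $p_t(x,y)$ is bounded above and below by expressions of the form $$\frac{C}{\sigma_{\alpha_1/\beta_1,\alpha_2/\beta_2}(t)}\exp\Big(-c\Big(\frac{d(x,y)^{\beta_1}}t\Big)^{\frac1{\beta_1-1}}\Big)\ \text{if } t<d(x,y),\qquad \frac{C}{\sigma_{\alpha_1/\beta_1,\alpha_2/\beta_2}(t)}\exp\Big(-c\Big(\frac{d(x,y)^{\beta_2}}t\Big)^{\frac1{\beta_2-1}}\Big)\ \text{if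 } t\ge d(x,y),$$ for $x,y\in X$, $t>0$, with positive constants $c,C$ that may differ in the upper and lower bounds. ${\rm wBE}(\kappa_1,\kappa_2)$: there is $C_{\rm wBE}>0$ with $|P_tf(x)-P_tf(y)|\le C_{\rm wBE}\frac{\sigma_{\kappa_1,\kappa_2}(d(x,y))}{\sigma_{\kappa_1/\beta_1,\kappa_2/\beta_2}(t)}\|f\|_{L^\infty}$ for all $x,y\in X$, $t>0$, $f\in L^\infty(X,\mu)$. Besov class: for non-decreasing $h:[0,\infty)\to[0,\infty)$ with $h(0)=0$ and $f\in L^p(X,\mu)$, $\|f\|_{p,h}:=\sup_{t>0}\frac1{h(t)}\big(\int_XP_t(|f-f(y)|^p)(y)\,d\mu(y)\big)^{1/p}$, where $P_t(|f-f(y)|^p)(y)=\int_X|f(x)-f(y)|^pp_t(y,x)\,d\mu(x)$, and $\mathbf{B}^{p,h}(X):=\{f\in L^p(X,\mu):\|f\|_{p,h}<\infty\}$. *)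

(* Defs.v *)
From HB Require Import structures.
From mathcomp Require Import all_boot all_order all_algebra.
From mathcomp Require Import all_classical all_reals all_analysis.

Set Implicit Arguments.
Unset Strict Implicit.
Unset Printing Implicit Defensive.

Import Order.TTheory GRing.Theory Num.Theory.
Import numFieldNormedType.Exports.

Local Open Scope classical_set_scope.
Local Open Scope ring_scope.

(* Nonempty complete metric spaces (complete and measurable types are pointed
   in the library). *)
#[short(type="completeMetricType")]
HB.structure Definition CompleteMetric (R : realType) :=
  { X of Complete X & Metric R X }.

(* X with its Borel sigma-algebra; borel X and X are convertible. *)
Definition borel (R : realType) (X : completeMetricType R) :=
  g_sigma_algebraType (@open X).

(* sigma_{a,b}(x) = x^a on [0,1] and x^b on (1,+oo) *)
Definition sigma (R : realType) (a b x : R) : R :=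
  x `^ a * \1_(`[0, 1] : set R) x + x `^ b * \1_(`]1, +oo[ : set R) x.

Section space.
Context {R : realType} {X : completeMetricType R}.
Variable mu : {measure set (borel X) -> \bar R}.

Definition radon : Prop :=
  [/\ forall K : set X, compact K -> (mu K < +oo)%E,
      forall A : set (borel X), measurable A ->
        mu A = ereal_inf [set mu U | U in [set U : set X | open U /\ A `<=` U]]
    & forall U : set X, open U ->
        mu U = ereal_sup
          [set mu K | K in [set K : set X | compact K /\ K `<=` U]]].

Definition doubling : Prop :=
  exists2 C : R, 0 < C & forall (x : X) (r : R), 0 < r ->
    [/\ (0 < mu (ball x (2 * r)))%E,
        (mu (ball x (2 * r)) <= C%:E * mu (ball x r))%E
      & (C%:E * mu (ball x r) < +oo)%E].

Definition volume_growth (a1 a2 : R) : Prop :=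
  exists2 C : R, 0 < C & forall (x : X) (r : R), 0 < r ->
    ((C^-1 * sigma a1 a2 r)%:E <= mu (ball x r) <= (C * sigma a1 a2 r)%:E)%E.

Definition inner2 (f g : X -> R) : R := \int[mu]_x (f x * g x).

Definition norm2 (f : X -> R) : \bar R := ('N[mu]_(2%:E)[EFin \o f])%E.

(* Elements of L^2(X,mu) are represented by functions; all the notions below
   are invariant under a.e. equality. *)
Definition form1 (E : (X -> R) -> (X -> R) -> R) (f : X -> R) : R :=
  E f f + inner2 f f.

(* (E, F) is a Dirichlet form on L^2(X,mu): a densely defined, symmetric,
   nonnegative bilinear form which is closed (F is complete for E_1) and on
   which the unit contraction operates. *)
Record is_dirichlet_form
    (F : set (X -> R)) (E : (X -> R) -> (X -> R) -> R) : Prop := {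
  df_L2 : forall f, F f -> f \in Lfun mu 2%:E ;
  df_ae : forall f g : X -> R, F f -> g \in Lfun mu 2%:E -> f = g %[ae mu] ->
    F g /\ forall h, F h -> E f h = E g h ;
  df_zero : F (cst 0) ;
  df_comb : forall a f g, F f -> F g -> F (fun x => a * f x + g x) ;
  df_dense : forall f : X -> R, f \in Lfun mu 2%:E -> forall e : R, 0 < e ->
    exists2 g, F g & (norm2 (f \- g)%R < e%:E)%E ;
  df_sym : forall f g : X -> R, F f -> F g -> E f g = E g f ;
  df_linear : forall a f g h, F f -> F g -> F h ->
    E (fun x => a * f x + g x) h = a * E f h + E g h ;
  df_ge0 : forall f, F f -> 0 <= E f f ;
  df_closed : forall u : nat -> X -> R, (forall n, F (u n)) ->
    (forall e : R, 0 < e -> exists N : nat, forall m n : nat,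
      (N <= m)%N -> (N <= n)%N -> form1 E (u m \- u n) < e) ->
    exists2 f, F f & form1 E (u n \- f) @[n --> \oo] --> (0 : R) ;
  df_markov : forall f, F f ->
    F (fun x => Num.min (Num.max (f x) 0) 1) /\
    E (fun x => Num.min (Num.max (f x) 0) 1)
      (fun x => Num.min (Num.max (f x) 0) 1) <= E f f }.

(* f is in the domain of the nonpositive self-adjoint operator A associated with
   (E, F), and A f = h *)
Definition form_generator (F : set (X -> R)) (E : (X -> R) -> (X -> R) -> R)
    (f h : X -> R) : Prop :=
  [/\ F f, h \in Lfun mu 2%:E & forall g, F g -> E f g = - inner2 h g].

(* P is the heat semigroup of (E, F): the strongly continuous semigroup of
   symmetric contractions of L^2(X,mu) whose infinitesimal generator is the
   operator associated with (E, F). *)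
Record is_heat_semigroup
    (F : set (X -> R)) (E : (X -> R) -> (X -> R) -> R)
    (P : R -> (X -> R) -> (X -> R)) : Prop := {
  hs_L2 : forall (t : R) (f : X -> R), 0 <= t ->
    f \in Lfun mu 2%:E -> P t f \in Lfun mu 2%:E ;
  hs_ae : forall (t : R) (f g : X -> R), 0 <= t ->
    f \in Lfun mu 2%:E -> g \in Lfun mu 2%:E ->
    f = g %[ae mu] -> P t f = P t g %[ae mu] ;
  hs_linear : forall (t a : R) (f g : X -> R), 0 <= t ->
    f \in Lfun mu 2%:E -> g \in Lfun mu 2%:E ->
    P t (fun x => a * f x + g x) = (fun x => a * P t f x + P t g x) %[ae mu] ;
  hs_zero : forall f : X -> R, f \in Lfun mu 2%:E -> P 0 f = f %[ae mu] ;
  hs_add : forall (s t : R) (f : X -> R), 0 <= s -> 0 <= t ->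
    f \in Lfun mu 2%:E ->
    P (s + t) f = P s (P t f) %[ae mu] ;
  hs_contraction : forall (t : R) (f : X -> R), 0 <= t -> f \in Lfun mu 2%:E ->
    (norm2 (P t f) <= norm2 f)%E ;
  hs_sym : forall (t : R) (f g : X -> R), 0 <= t ->
    f \in Lfun mu 2%:E -> g \in Lfun mu 2%:E ->
    inner2 (P t f) g = inner2 f (P t g) ;
  hs_continuous : forall f : X -> R, f \in Lfun mu 2%:E ->
    norm2 (P t f \- f) @[t --> (0 : R)^'+] --> (0 : \bar R)%E ;
  hs_generator : forall f h : X -> R,
    f \in Lfun mu 2%:E -> h \in Lfun mu 2%:E ->
    form_generator F E f h <->
    norm2 (fun x => t^-1 * (P t f x - f x) - h x)
      @[t --> (0 : R)^'+] --> (0 : \bar R)%E }.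

Record is_heat_kernel
    (P : R -> (X -> R) -> (X -> R)) (pt : R -> X -> X -> R) : Prop := {
  hk_measurable : forall t : R, 0 < t ->
    measurable_fun [set: (borel X * borel X)%type] (fun z => pt t z.1 z.2) ;
  hk_kernel : forall (t : R) (f : X -> R), 0 < t -> f \in Lfun mu 2%:E ->
    P t f = (fun x => \int[mu]_y (pt t x y * f y)) %[ae mu] }.

(* P_t f for f in any L^p(X,mu), 1 <= p <= +oo, extended from L^2(X,mu) through
   the heat kernel. *)
Definition heat (pt : R -> X -> X -> R) (t : R) (f : X -> R) (x : X) : R :=
  if 0 < t then \int[mu]_y (pt t x y * f y) else f x.

Definition conservative (pt : R -> X -> X -> R) : Prop :=
  forall t, 0 <= t -> heat pt t (cst 1) = cst 1 %[ae mu].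

Definition wBE (pt : R -> X -> X -> R) (b1 b2 k1 k2 : R) : Prop :=
  exists2 C : R, 0 < C &
    forall (x y : X) (t : R) (f : X -> R), 0 < t -> f \in Lfun mu +oo%E ->
      (`|heat pt t f x - heat pt t f y|%:E <=
       (C * (sigma k1 k2 (mdist x y) / sigma (k1 / b1) (k2 / b2) t))%:E
         * 'N[mu]_(+oo)[EFin \o f])%E.

(* (\int_X P_t(|f - f(y)|^p)(y) dmu(y))^(1/p) *)
Definition heat_variation (pt : R -> X -> X -> R) (p : R) (f : X -> R) (t : R)
    : \bar R :=
  ((\int[mu]_y \int[mu]_x (`|f x - f y| `^ p * pt t y x)%:E) `^ p^-1)%E.

(* The inverse is that of \bar R: it is +oo at a zero of h. *)
Definition besov_seminorm (pt : R -> X -> X -> R) (p : R) (h : R -> R)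
    (f : X -> R) : \bar R :=
  ereal_sup [set ((h t)%:E^-1 * heat_variation pt p f t)%E
            | t in [set t : R | 0 < t]].

Definition besov (pt : R -> X -> X -> R) (p : R) (h : R -> R) : set (X -> R) :=
  [set f | f \in Lfun mu p%:E /\ (besov_seminorm pt p h f < +oo)%E].

End space.

(* The two-scale sub-Gaussian expression at time t and distance d *)
Definition sub_gaussian (R : realType) (a1 a2 b1 b2 c C t d : R) : R :=
  if t < d then
    C / sigma (a1 / b1) (a2 / b2) t
      * expR (- (c * (d `^ b1 / t) `^ (b1 - 1)^-1))
  else
    C / sigma (a1 / b1) (a2 / b2) t
      * expR (- (c * (d `^ b2 / t) `^ (b2 - 1)^-1)).

Definition heat_kernel_bounds (R : realType) (X : completeMetricType R)
    (pt : R -> X -> X -> R) (a1 a2 b1 b2 : R) : Prop :=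
  (exists c C : R, [/\ 0 < c, 0 < C & forall (x y : X) (t : R), 0 < t ->
     pt t x y <= sub_gaussian a1 a2 b1 b2 c C t (mdist x y)]) /\
  (exists c C : R, [/\ 0 < c, 0 < C & forall (x y : X) (t : R), 0 < t ->
     sub_gaussian a1 a2 b1 b2 c C t (mdist x y) <= pt t x y]).

(* The exponent (1 - 2/p) kappa/beta + 1/p *)
Definition besov_exponent (R : realType) (p k b : R) : R :=
  (1 - 2 / p) * (k / b) + 1 / p.

(* Main.v *)
Require Import Defs.
From HB Require Import structures.
From mathcomp Require Import all_boot all_order all_algebra.
From mathcomp Require Import all_classical all_reals all_analysis.
From mathcomp Require Import measurable_realfun.
From mathcomp Require Import ring lra.

Set Implicit Arguments.
Unset Strict Implicit.
Unset Printing Implicit Defensive.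

Import Order.TTheory GRing.Theory Num.Theory.
Import numFieldNormedType.Exports.

Local Open Scope classical_set_scope.
Local Open Scope ring_scope.

(** The inequality is proved by duality and a telescoping sum in discrete time.
    Fix a small scale [s] and divide [[0, t]] into [N] steps of length [tau]
    comparable to [s]. For a bounded integrable test function [g],
[[
    \int (P_t f - f) g = \int f (P_t g - g)
                       = \sum_(j < N) \int f (P_tau g_j - g_j),
]]
    where [g_j = P_(j tau) g]. By the symmetry of the heat kernel each term is,
    up to the factor [-1/2], the Dirichlet form at time [tau]
[[
    \int \int p_tau(x, y) (f x - f y) (g_j x - g_j y) d mu(x) d mu(y),
]]
    which Hoelder's inequality separates into the [L^p] variation of [f] at time
    [tau] and the [L^q] variation of [g_j], with [1/p + 1/q = 1] and so [2 <= q].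

    The variation of [g_j] is small for two reasons. In [L^2] it is a decrement
    of the energy of [g] along the semigroup, which is nonnegative and convex in
    time, hence it is at most [|g|^2 / j] ([semigroup_form_decay]). In [L^oo] the
    weak Bakry-Emery condition bounds it by [sigma (d(x, y)) / sigma (j tau)].
    Interpolating between the two ([marcinkiewicz]) yields the exponent [q], at
    the price of a weight, a power of [sigma (d(x, y))], which Hoelder's
    inequality transfers to the variation of [f]; for [p = 1] and [p = 2] one of
    the two bounds suffices. The weight is absorbed
    by the heat kernel: [sigma (d)^(2 - p) p_tau] is at most a power of [s] times
    [p_s] as soon as [tau] is [s] divided by a large constant
    ([sub_gaussian_rescale]). The resulting bound on the [j]-th term
    ([regularized_increment_le]) sums over [j] to a Riemann sum for the
    derivative of [Psi_p] ([time_steps_sum_le]); the term [j = 0], where no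
    regularization is available, is bounded crudely ([first_increment_le]).

    This gives, for each small [s] separately ([heat_pseudo_Poincare]),
[[
    |P_t f - f|_p <= C Psi_p(t) s^(- alpha) (\int P_s(|f - f(y)|^p)(y))^(1/p)
]]
    with [alpha] the Besov exponent at small times, and the theorem follows by
    taking the lower limit in [s]. *)

(** * Powers, dyadic sums and the function sigma *)

Section powR_extra.
Context {R : realType}.
Implicit Types (a e l u v x y t : R) (n : nat).

Let one_powR e : (1:R) `^ e = 1. Proof. by rewrite powR1. Qed.

Lemma powR_gt1 a e : 1 < a -> 0 < e -> 1 < a `^ e.
Proof.
move=> a1 e0; rewrite -[X in X < _](one_powR e).
by apply: gt0_ltr_powR => //; rewrite nnegrE ltW// (lt_trans _ a1).
Qed.

Lemma powR_le1 x e : 0 <= x <= 1 -> 0 <= e -> x `^ e <= 1.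
Proof.
move=> /andP[x0 x1] e0; rewrite -[X in _ <= X](one_powR e).
by rewrite ge0_ler_powR ?nnegrE.
Qed.

(** The tangent at [x] of the concave function [z `^ a] lies above its graph. *)
Lemma powR_concave_increment a x y : 0 < a <= 1 -> 0 < x -> 0 <= y <= x ->
  x `^ (a - 1) * (x - y) <= (x `^ a - y `^ a) / a.
Proof.
move=> /andP[a0]; rewrite le_eqVlt => /predU1P[->|a1] x0 /andP[y0 yx].
  by rewrite subrr powRr0 mul1r divr1 !powRr1// ltW.
have z0 : 0 <= y / x by rewrite divr_ge0// ltW.
have : (y / x) `^ a <= a * (y / x) + (1 - a).
  have := @conjugate_powR R ((y / x) `^ a) 1 a^-1 (1 - a)^-1 (powR_ge0 _ _) ler01.
  rewrite !invr_gt0 !invrK subr_gt0 => /(_ a0 a1); rewrite addrC subrK => /(_ erefl).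
  by rewrite mulr1 -powRrM divff ?gt_eqF// powRr1// powR1 mul1r [_ * a]mulrC.
rewrite -(ler_pM2r (powR_gt0 a x0)) -powRM// ?divr_ge0 ?(ltW x0)//.
rewrite divfK ?gt_eqF// => h.
have xa : x `^ a = x `^ (a - 1) * x.
  by rewrite powRB ?(gt_eqF x0) ?implybT// powRr1 ?divfK ?gt_eqF// ltW.
rewrite ler_pdivlMr// lerBrDl -lerBrDr.
apply: le_trans h _; rewrite {1}xa xa le_eqVlt; apply/orP; left; apply/eqP.
by field; rewrite gt_eqF.
Qed.

Lemma powR_Riemann_sum a x n : 0 < a <= 1 -> 0 < x ->
  \sum_(j < n) (j.+1%:R * x) `^ (a - 1) * x <= (n%:R * x) `^ a / a.
Proof.
move=> a01 x0; have a0 : 0 < a by case/andP: a01.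
elim: n => [|n IH]; first by rewrite big_ord0 divr_ge0 ?powR_ge0 ?ltW.
rewrite big_ord_recr/=.
have := @powR_concave_increment a (n.+1%:R * x) (n%:R * x) a01.
rewrite -mulrBl -natrB// subSnn mul1r => /(_ _ _)/(lerD IH) h.
rewrite (le_trans (h _ _))//; first by rewrite mulr_gt0.
- by rewrite mulr_ge0 ?(ltW x0)//= ler_wpM2r ?ler_nat// ltW.
- by rewrite le_eqVlt; apply/orP; left; apply/eqP; ring.
Qed.

(** Once the summation stops at abscissa [1], the bound no longer depends on
    the number of terms. *)
Lemma powR_Riemann_sum_le1 a x n : 0 < a <= 1 -> 0 < x ->
  \sum_(j < n | j.+1%:R * x <= 1) (j.+1%:R * x) `^ (a - 1) * x <= a^-1.
Proof.
move=> a01 x0; have a0 : 0 < a by case/andP: a01.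
elim: n => [|n IH]; first by rewrite big_ord0 invr_ge0 ltW.
rewrite big_mkcond big_ord_recr/= -big_mkcond/=; case: ifPn => [le1|_]; last first.
  by rewrite addr0.
apply: (@le_trans _ _ (\sum_(j < n.+1) (j.+1%:R * x) `^ (a - 1) * x)).
  rewrite big_ord_recr/= lerD2r [leLHS]big_mkcond; apply: ler_sum => j _.
  by case: ifPn => // _; rewrite mulr_ge0 ?powR_ge0// ltW.
apply: le_trans (powR_Riemann_sum _ a01 x0) _.
rewrite ler_piMl ?invr_ge0 ?(ltW a0)// -[X in _ <= X](one_powR a).
by rewrite ge0_ler_powR ?nnegrE ?mulr_ge0// ltW.
Qed.

Let dyadic_powR e l i : 0 < l ->
  (l * 2 ^+ i.+1) `^ e = 2 `^ e * (l * 2 ^+ i) `^ e.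
Proof.
move=> l0; rewrite exprS mulrCA [LHS]powRM//.
by rewrite mulr_ge0 ?exprn_ge0// ltW.
Qed.

Lemma dyadic_sum_le_last e l n : 0 < e -> 0 < l ->
  \sum_(i < n) (l * 2 ^+ i) `^ e <= (l * 2 ^+ n) `^ e / (2 `^ e - 1).
Proof.
move=> e0 l0; have r1 : 1 < (2:R) `^ e by rewrite powR_gt1// ltr1n.
elim: n => [|n IH].
  by rewrite big_ord0 divr_ge0 ?powR_ge0 ?subr_ge0 1?ltW.
rewrite big_ord_recr /= dyadic_powR//.
apply: (le_trans (lerD IH (lexx _))).
rewrite le_eqVlt; apply/orP; left; apply/eqP; field.
by rewrite subr_eq0 gt_eqF.
Qed.

Lemma dyadic_sum_below e l v n : 0 < e -> 0 < l -> 0 <= v ->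
  \sum_(i < n | l * 2 ^+ i < v) (l * 2 ^+ i) `^ e <=
  2 `^ e / (2 `^ e - 1) * v `^ e.
Proof.
move=> e0 l0 v0; have r1 : 1 < (2:R) `^ e by rewrite powR_gt1// ltr1n.
elim: n => [|n IH].
  by rewrite big_ord0 mulr_ge0 ?powR_ge0// divr_ge0 ?powR_ge0// subr_ge0 ltW.
rewrite big_mkcond big_ord_recr/= -big_mkcond/=; case: ifPn => [lv|_]; last first.
  by rewrite addr0.
apply: (@le_trans _ _ (\sum_(i < n.+1) (l * 2 ^+ i) `^ e)).
  rewrite big_ord_recr/= lerD2r [leLHS]big_mkcond; apply: ler_sum => j _.
  by case: ifPn => // _; rewrite powR_ge0.
apply: le_trans (dyadic_sum_le_last _ e0 l0) _.
rewrite dyadic_powR// mulrAC ler_wpM2l//.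
  by rewrite divr_ge0 ?powR_ge0// subr_ge0 ltW.
by rewrite ge0_ler_powR ?nnegrE ?mulr_ge0 ?exprn_ge0 ?(ltW lv)// ltW.
Qed.

(** At the dyadic scale [l * 2 ^+ i] of [u], the bound [u <= 2 * h i] pays for
    the whole of [u `^ (2 + e)]; the scales below [l] are covered by the first
    term. *)
Lemma dyadic_powR_le e l u (h : nat -> R) n : 0 < e -> 0 < l -> 0 <= u ->
  (forall i, l * 2 ^+ i <= u -> u <= 2 * h i) -> u < l * 2 ^+ n ->
  u `^ e * u ^+ 2 <= l `^ e * u ^+ 2 +
    \sum_(i < n) 4 * 2 `^ e * (l * 2 ^+ i) `^ e * h i ^+ 2.
Proof.
move=> e0 l0 u0 uh; elim: n => [|n IH].
  rewrite expr0 mulr1 big_ord0 addr0 => ul; rewrite ler_wpM2r ?sqr_ge0//.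
  by rewrite ge0_ler_powR ?nnegrE// ltW.
move=> un; have [/IH|] := ltP u (l * 2 ^+ n).
  move=> /le_trans; apply; rewrite lerD2l big_ord_recr/= lerDl.
  by rewrite mulr_ge0 ?sqr_ge0// !mulr_ge0 ?powR_ge0.
move=> nu; apply: (@le_trans _ _ (4 * 2 `^ e * (l * 2 ^+ n) `^ e * h n ^+ 2)).
  have -> : 4 * 2 `^ e * (l * 2 ^+ n) `^ e * h n ^+ 2 =
            (l * 2 ^+ n.+1) `^ e * (2 * h n) ^+ 2.
    by rewrite dyadic_powR//; ring.
  rewrite ler_pM ?powR_ge0 ?sqr_ge0//.
    by rewrite ge0_ler_powR ?nnegrE ?mulr_ge0 ?exprn_ge0 ?(ltW un)// ltW.
  by rewrite ler_pXn2r ?nnegrE ?(le_trans u0)// uh.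
rewrite big_ord_recr/= addrA lerDr addr_ge0// ?mulr_ge0 ?powR_ge0 ?sqr_ge0//.
by apply: sumr_ge0 => i _; rewrite mulr_ge0 ?sqr_ge0// !mulr_ge0 ?powR_ge0.
Qed.

(** [x `^ e * expR (- x)] is bounded, with maximum at [x = e]. *)
Lemma powR_expRN_le e x : 0 <= e -> 0 < x -> x `^ e * expR (- x) <= e `^ e.
Proof.
rewrite le_eqVlt => /predU1P[<- x0|e0 x0].
  by rewrite !powRr0 mul1r -expR0 ler_expR oppr_le0 ltW.
rewrite /powR (gt_eqF x0) (gt_eqF e0) -expRD ler_expR.
have := @le_ln1Dx R (x / e - 1).
rewrite addrCA subrr addr0 ltrBrDr addNr divr_gt0// => /(_ isT).
rewrite ln_div ?posrE// => /(ler_wpM2l (ltW e0)).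
rewrite !mulrBr mulr1 mulrCA divff ?gt_eqF// mulr1.
lra.
Qed.

End powR_extra.

Section sigma_lemmas.
Context {R : realType}.
Implicit Types a b x y t : R.

Let one_powR (e : R) : (1:R) `^ e = 1. Proof. by rewrite powR1. Qed.

Lemma sigma_le1 a b x : 0 <= x <= 1 -> sigma a b x = x `^ a.
Proof.
move=> x01; rewrite /sigma !indicE mem_set/= ?in_itv//= mulr1 memNset/=.
  by rewrite mulr0 addr0.
by rewrite in_itv/= andbT; apply/negP; rewrite -leNgt; case/andP: x01.
Qed.

Lemma sigma_gt1 a b x : 1 < x -> sigma a b x = x `^ b.
Proof.
move=> x1; rewrite /sigma !indicE memNset/=; last first.
  by rewrite in_itv/= => /andP[_]; rewrite leNgt x1.
by rewrite mulr0 add0r mem_set ?mulr1//= in_itv/= x1.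
Qed.

Lemma sigma_ge0 a b x : 0 <= sigma a b x.
Proof. by rewrite addr_ge0// mulr_ge0 ?powR_ge0. Qed.

Lemma sigma_gt0 a b x : 0 < x -> 0 < sigma a b x.
Proof.
move=> x0; have [x1|x1] := leP x 1.
  by rewrite sigma_le1 ?(ltW x0)// powR_gt0.
by rewrite sigma_gt1// powR_gt0.
Qed.

Lemma le_sigma a b x y : 0 <= a -> 0 <= b -> 0 <= x <= y ->
  sigma a b x <= sigma a b y.
Proof.
move=> a0 b0 /andP[x0 xy]; have [y1|y1] := leP y 1.
  rewrite !sigma_le1 ?x0 ?(le_trans xy)// ?(le_trans x0 xy)//.
  by rewrite ge0_ler_powR ?nnegrE// (le_trans x0).
rewrite (sigma_gt1 _ _ y1); have [x1|x1] := leP x 1; last first.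
  by rewrite sigma_gt1// ge0_ler_powR ?nnegrE// (le_trans x0).
rewrite sigma_le1 ?x0// (@le_trans _ _ 1)//.
  by rewrite -[leRHS](one_powR a) ge0_ler_powR ?nnegrE.
by rewrite -[leLHS](one_powR b) ge0_ler_powR ?nnegrE// ltW// (lt_trans _ y1).
Qed.

(** Discrete form of [\int_0^t sigma (a - 1) (b - 1) <= C * sigma a b t]. *)
Lemma sigma_Riemann_sum a b x t n : 0 < a <= 1 -> 0 < b <= 1 -> 0 < x ->
  n%:R * x <= t ->
  \sum_(j < n) sigma (a - 1) (b - 1) (j.+1%:R * x) * x <=
  (a^-1 + b^-1) * sigma a b t.
Proof.
move=> a01 b01 x0 nxt; have [a0 a1] := andP a01; have [b0 b1] := andP b01.
have jx0 j : 0 <= j.+1%:R * x by rewrite mulr_ge0 1?ltW.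
have nx0 : 0 <= n%:R * x by rewrite mulr_ge0// ltW.
have t0 : 0 <= t by exact: le_trans nxt.
have [t1|t1] := leP t 1.
  have jx1 (j : 'I_n) : j.+1%:R * x <= 1.
    by rewrite (le_trans _ t1)// (le_trans _ nxt)// ler_wpM2r ?ler_nat// ltW.
  under eq_bigr => j _ do rewrite sigma_le1 ?jx0 ?jx1//.
  apply: le_trans (powR_Riemann_sum _ a01 x0) _.
  rewrite sigma_le1 ?t0// mulrC ler_pM ?invr_ge0 ?powR_ge0 ?(ltW a0)//.
    by rewrite lerDl invr_ge0 ltW.
  by rewrite ge0_ler_powR ?nnegrE// ltW.
rewrite sigma_gt1// mulrDl; apply: (@le_trans _ _ (
    \sum_(j < n | j.+1%:R * x <= 1) (j.+1%:R * x) `^ (a - 1) * x +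
    \sum_(j < n) (j.+1%:R * x) `^ (b - 1) * x)).
  rewrite [X in _ <= X + _]big_mkcond -big_split/=; apply: ler_sum => j _.
  case: ifPn => [jx1|].
    by rewrite sigma_le1 ?jx0// lerDl mulr_ge0 ?powR_ge0// ltW.
  by rewrite -ltNge => jx1; rewrite sigma_gt1// add0r.
apply: lerD.
  apply: le_trans (powR_Riemann_sum_le1 _ a01 x0) _.
  rewrite ler_peMr ?invr_ge0 ?(ltW a0)// -[X in X <= _](one_powR b).
  by rewrite ge0_ler_powR ?nnegrE// ltW// (lt_trans _ t1).
apply: le_trans (powR_Riemann_sum _ b01 x0) _.
rewrite mulrC ler_wpM2l ?invr_ge0 ?(ltW b0)//.
by rewrite ge0_ler_powR ?nnegrE// ltW.
Qed.

End sigma_lemmas.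

(** * Comparison of sub-Gaussian bounds at comparable times *)

Section heat_kernel_rescaling.
Context {R : realType}.
Implicit Types (a b c k m s t d K cu Cu cl Cl E : R).

Lemma powR_sub_gaussian_le b k s d : 1 < b -> 0 <= k -> 0 < s -> 0 < d ->
  d `^ k * expR (- (d `^ b / s) `^ (b - 1)^-1) <=
  s `^ (k / b) * ((b - 1) * k / b) `^ ((b - 1) * k / b).
Proof.
move=> b1 k0 s0 d0; set X := (_ / s) `^ _.
have b0 : 0 < b by rewrite (lt_trans _ b1).
have bB : b - 1 != 0 by rewrite subr_eq0 gt_eqF.
have X0 : 0 < X by rewrite powR_gt0// divr_gt0// powR_gt0.
have -> : d `^ k = s `^ (k / b) * X `^ ((b - 1) * k / b).
  have -> : d `^ k = (s * (d `^ b / s)) `^ (k / b).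
    by rewrite mulrCA divff ?gt_eqF// mulr1 -powRrM mulrCA divff ?gt_eqF// mulr1.
  rewrite powRM ?divr_ge0 ?powR_ge0 ?(ltW s0)//; congr (_ * _).
  by rewrite /X -powRrM; congr (_ `^ _); field; rewrite bB gt_eqF.
rewrite -mulrA ler_wpM2l ?powR_ge0// powR_expRN_le//.
by rewrite divr_ge0 ?mulr_ge0 ?subr_ge0// ltW.
Qed.

Lemma sigma_sub_gaussian_le b k1 k2 m : 1 < b -> 0 < k1 -> 0 < k2 -> 0 <= m ->
  exists2 K, 0 < K & forall s d, 0 < s <= 1 -> 0 < d ->
  sigma k1 k2 d `^ m * expR (- (d `^ b / s) `^ (b - 1)^-1) <=
  K * s `^ (m * (k1 / b)).
Proof.
(* Beyond distance [1] the power [k2] of [d] is replaced by the larger of [k1]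
   and [k2], so that the power of [s <= 1] obtained is at least [m * (k1 / b)]. *)
move=> b1 k10 k20 m0; pose e k := (b - 1) * (k * m) / b.
pose k := Num.max k1 k2.
have b0 : 0 < b by rewrite (lt_trans _ b1).
have kk1 : k1 <= k by rewrite le_max lexx.
have k0 : 0 < k by rewrite (lt_le_trans _ kk1).
exists (1 + e k1 `^ e k1 + e k `^ e k).
  by rewrite -addrA ltr_pwDl// addr_ge0 ?powR_ge0.
move=> s d /andP[s0 s1] d0; rewrite [m * _]mulrA [m * k1]mulrC.
have [d1|d1] := leP d 1.
  rewrite sigma_le1 ?(ltW d0)// -powRrM.
  apply: le_trans (powR_sub_gaussian_le _ _ _ _) _ => //.
    by rewrite mulr_ge0// ltW.
  rewrite [X in X <= _]mulrC ler_wpM2r ?powR_ge0// -/(e k1) addrAC lerDr.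
  by rewrite addr_ge0 ?powR_ge0.
rewrite sigma_gt1// -powRrM.
apply: (@le_trans _ _ (d `^ (k * m) * expR (- (d `^ b / s) `^ (b - 1)^-1))).
  rewrite ler_wpM2r ?expR_ge0// ler_powR ?(ltW d1)// ler_wpM2r//.
  by rewrite le_max lexx orbT.
apply: le_trans (powR_sub_gaussian_le _ _ _ _) _ => //.
  by rewrite mulr_ge0// ltW.
rewrite [X in X <= _]mulrC -/(e k) ler_pM ?powR_ge0//.
  by rewrite lerDr addr_ge0 ?powR_ge0.
by apply: ger_powR; rewrite ?s0//= ler_wpM2r ?invr_ge0 ?(ltW b0)// ler_wpM2r.
Qed.

(** Running the kernel of the lower bound a constant factor [c] longer than that
    of the upper bound turns the exponential factor of the former into that of
    the latter, with room to spare; the spare decay absorbs the powers of [d].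
    As [s <= 1], points at distance [d <= s] make the exponential irrelevant and
    points at distance [s < d] only see the exponent [b1]. *)
Lemma sub_gaussian_rescale a1 a2 b1 b2 k1 k2 cu Cu cl Cl :
  0 <= a1 -> 2 <= b1 -> 2 <= b2 -> 0 < k1 -> 0 < k2 ->
  0 < cu -> 0 < Cu -> 0 < cl -> 0 < Cl ->
  exists2 c, 1 <= c & forall m, 0 <= m -> exists2 K, 0 < K &
  forall s t d, 0 < s <= 1 -> s / (2 * c) <= t <= s / c -> 0 <= d ->
  sigma k1 k2 d `^ m * sub_gaussian a1 a2 b1 b2 cu Cu t d <=
  K * s `^ (m * (k1 / b1)) * sub_gaussian a1 a2 b1 b2 cl Cl s d.
Proof.
move=> a10 b12 b22 k10 k20 cu0 Cu0 cl0 Cl0.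
have b11 : 1 < b1 by rewrite (lt_le_trans _ b12)// ltr1n.
have b10 : 0 < b1 by rewrite (lt_trans _ b11).
have b21 : 1 < b2 by rewrite (lt_le_trans _ b22)// ltr1n.
have b20 : 0 < b2 by rewrite (lt_trans _ b21).
pose g := (b1 - 1)^-1; have g0 : 0 < g by rewrite invr_gt0 subr_gt0.
(* Speeding up by [c] multiplies the exponent by [c `^ g], which has to turn
   [cu] into [cl] plus the unit spent on [sigma k1 k2 d `^ m]. *)
pose c := Num.max 1 (((cl + 1) / cu) `^ g^-1).
have c1 : 1 <= c by rewrite le_max lexx.
have c0 : 0 < c by rewrite (lt_le_trans _ c1).
have cg : cl + 1 <= cu * c `^ g.
  rewrite mulrC -ler_pdivrMr//.
  have h : ((cl + 1) / cu) `^ g^-1 <= c by rewrite le_max lexx orbT.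
  have := ge0_ler_powR (ltW g0) _ _ h; rewrite !nnegrE powR_ge0 (ltW c0).
  move=> /(_ isT isT); rewrite -powRrM mulVf ?gt_eqF// powRr1//.
  by rewrite divr_ge0 ?addr_ge0// ltW.
exists c => // m m0.
have [K0 K00 hK0] := sigma_sub_gaussian_le b11 k10 k20 m0.
pose A := (2 * c) `^ (a1 / b1).
have A0 : 0 < A by rewrite powR_gt0 ?mulr_gt0.
exists ((K0 + expR cl) * (Cu / Cl) * A).
  by rewrite !mulr_gt0 ?invr_gt0 ?addr_gt0 ?expR_gt0.
move=> s t d /andP[s0 s1] /andP[tl tu] d0.
have t0 : 0 < t by rewrite (lt_le_trans _ tl)// divr_gt0// mulr_gt0.
have ts : t <= s.
  by rewrite (le_trans tu)// ler_pdivrMr// ler_peMr// ltW.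
have t1 : t <= 1 by exact: le_trans s1.
have sA : s `^ (a1 / b1) <= A * t `^ (a1 / b1).
  rewrite -powRM ?mulr_ge0 ?(ltW c0) ?(ltW t0)//.
  rewrite ge0_ler_powR ?nnegrE ?divr_ge0 ?mulr_ge0 ?(ltW b10) ?(ltW s0)//.
  - by rewrite ltW.
  - by rewrite ltW.
  - by rewrite mulrC -ler_pdivrMr ?mulr_gt0.
have CA : Cu / sigma (a1 / b1) (a2 / b2) t <=
    Cu / Cl * A * (Cl / sigma (a1 / b1) (a2 / b2) s).
  rewrite !sigma_le1 ?(ltW s0) ?(ltW t0)//.
  have -> : Cu / Cl * A * (Cl / s `^ (a1 / b1)) = Cu * (A / s `^ (a1 / b1)).
    by field; rewrite !gt_eqF ?powR_gt0.
  rewrite ler_wpM2l// ?(ltW Cu0)// ler_pdivlMr ?powR_gt0//.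
  by rewrite mulrC ler_pdivrMr ?powR_gt0.
set S := sigma _ _ s in CA *.
have S0 : 0 < S by rewrite sigma_gt0.
have main E E' : 0 <= E -> 0 <= E' ->
    sigma k1 k2 d `^ m * E <= (K0 + expR cl) * s `^ (m * (k1 / b1)) * E' ->
    sigma k1 k2 d `^ m * (Cu / sigma (a1 / b1) (a2 / b2) t * E) <=
    (K0 + expR cl) * (Cu / Cl) * A * s `^ (m * (k1 / b1)) * (Cl / S * E').
  move=> E0 E'0 hE; rewrite mulrCA.
  apply: (@le_trans _ _ (Cu / Cl * A * (Cl / S) *
     ((K0 + expR cl) * s `^ (m * (k1 / b1)) * E'))).
    rewrite ler_pM//; first by rewrite divr_ge0 ?sigma_ge0// ltW.
    by rewrite mulr_ge0 ?powR_ge0.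
  by rewrite le_eqVlt; apply/orP; left; apply/eqP; ring.
have [ds|sd] := leP d s.
  rewrite /sub_gaussian (ltNge s d) ds/=.
  have lowE : expR (- cl) <= expR (- (cl * (d `^ b2 / s) `^ (b2 - 1)^-1)).
    rewrite ler_expR lerN2 ler_piMr ?(ltW cl0)//.
    apply: powR_le1; last by rewrite invr_ge0 subr_ge0 ltW.
    rewrite divr_ge0 ?powR_ge0 ?(ltW s0)//= ler_pdivrMr// mul1r.
    move: d0; rewrite le_eqVlt => /predU1P[<-|d0].
      by rewrite powR0 ?gt_eqF// ltW.
    by rewrite (le_trans _ ds)// ge1r_powR ?(ltW b21) ?d0 ?(le_trans ds s1).
  have upE E : E <= 1 -> sigma k1 k2 d `^ m * E <= s `^ (m * (k1 / b1)).
    move=> E1; apply: (@le_trans _ _ (sigma k1 k2 d `^ m)).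
      by rewrite ler_piMr ?powR_ge0.
    rewrite sigma_le1 ?d0 ?(le_trans ds)// -powRrM mulrC.
    apply: (@le_trans _ _ (s `^ (m * k1))).
      by rewrite ge0_ler_powR ?nnegrE ?mulr_ge0// ltW.
    apply: ger_powR; first by rewrite s0.
    rewrite ler_wpM2l// ler_pdivrMr// ler_peMr ?(ltW k10)// ltW//.
  have fin E E' : 0 <= E <= 1 -> expR (- cl) <= E' ->
    sigma k1 k2 d `^ m * E <= (K0 + expR cl) * s `^ (m * (k1 / b1)) * E'.
    move=> /andP[E0 E1] hE'; apply: (le_trans (upE _ E1)).
    apply: (@le_trans _ _ (expR cl * s `^ (m * (k1 / b1)) * expR (- cl))).
      by rewrite mulrAC -expRD addrN expR0 mul1r.
    by rewrite ler_pM ?expR_ge0 ?mulr_ge0 ?expR_ge0 ?powR_ge0// ler_wpM2r ?powR_ge0 ?lerDr// ltW.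
  have e01 x : 0 <= x -> 0 <= expR (- x) <= 1.
    by move=> x0; rewrite expR_ge0/= -[X in _ <= X]expR0 ler_expR oppr_le0.
  rewrite -/S; case: ifPn => _;
    refine (main _ _ (expR_ge0 _) (expR_ge0 _) (fin _ _ _ lowE));
    by apply: e01; rewrite mulr_ge0 ?powR_ge0// ltW.
have d00 : 0 < d by exact: lt_trans sd.
rewrite /sub_gaussian sd (le_lt_trans ts sd) -/S.
refine (main _ _ (expR_ge0 _) (expR_ge0 _) _).
set X := (d `^ b1 / s) `^ g.
have hX : (cl + 1) * X <= cu * (d `^ b1 / t) `^ g.
  apply: (@le_trans _ _ (cu * c `^ g * X)); first by rewrite ler_wpM2r ?powR_ge0.
  rewrite -mulrA ler_wpM2l ?(ltW cu0)// -powRM ?(ltW c0)//; last first.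
    by rewrite divr_ge0 ?powR_ge0// ltW.
  have sc0 : 0 < s / c by rewrite divr_gt0.
  have cst : c * (d `^ b1 / s) <= d `^ b1 / t.
    rewrite mulrCA ler_wpM2l ?powR_ge0// -invf_div lef_pV2 ?posrE//.
  by rewrite ge0_ler_powR ?nnegrE ?(le_trans _ cst) ?(ltW g0)// mulr_ge0
    ?divr_ge0 ?powR_ge0// ltW.
apply: (@le_trans _ _ (sigma k1 k2 d `^ m * expR (- X) * expR (- (cl * X)))).
  rewrite -mulrA ler_wpM2l ?powR_ge0// -expRD ler_expR -opprD lerN2.
  by move: hX; rewrite mulrDl mul1r addrC.
rewrite ler_wpM2r ?expR_ge0//; apply: (le_trans (hK0 _ _ _ d00)); rewrite ?s0//.
by rewrite ler_wpM2r ?powR_ge0// lerDl expR_ge0.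
Qed.

End heat_kernel_rescaling.

(** * Marcinkiewicz interpolation between L^2 and L^oo *)

Ltac measurability :=
  repeat first
    [ eassumption
    | match goal with H : forall _, measurable_fun _ _ |- _ => exact: H end
    | exact: measurable_cst
    | exact: measurable_id
    | exact: measurable_fst
    | exact: measurable_snd
    | apply: (measurableT_comp (@EFin_measurable _ _))
    | apply: measurable_funM
    | apply: measurable_funB
    | apply: measurable_funD
    | apply: measurable_funX
    | apply: measurable_sum => ?
    | apply: (measurableT_comp (@normr_measurable _ setT))
    | apply: (measurableT_comp (@measurable_powR _ _)) ].

Section nonnegative_integrals.
Context {d} {T : measurableType d} {R : realType}.
Variable mu : {measure set T -> \bar R}.
Implicit Types (f g : T -> R) (c p : R).

Lemma ge0_integral_scale c f : 0 <= c -> measurable_fun setT f ->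
  (forall x, 0 <= f x) ->
  (\int[mu]_x (c * f x)%:E = c%:E * \int[mu]_x (f x)%:E)%E.
Proof.
move=> c0 mf f0; under eq_integral do rewrite EFinM.
rewrite ge0_integralZl_EFin//; last exact/measurable_EFinP.
by move=> x _; rewrite lee_fin.
Qed.

Lemma ge0_integral_add f g :
  measurable_fun setT f -> measurable_fun setT g ->
  (forall x, 0 <= f x) -> (forall x, 0 <= g x) ->
  (\int[mu]_x (f x + g x)%:E = \int[mu]_x (f x)%:E + \int[mu]_x (g x)%:E)%E.
Proof.
move=> mf mg f0 g0; under eq_integral do rewrite EFinD.
by rewrite ge0_integralD//; first [exact/measurable_EFinP |
  by move=> x _; rewrite lee_fin].
Qed.

Lemma ge0_integral_bigsum n (f : 'I_n -> T -> R) :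
  (forall i, measurable_fun setT (f i)) -> (forall i x, 0 <= f i x) ->
  (\int[mu]_x (\sum_(i < n) f i x)%:E = \sum_(i < n) \int[mu]_x (f i x)%:E)%E.
Proof.
move=> mf f0; under eq_integral do rewrite -sumEFin.
by rewrite ge0_integral_sum// => i; [exact/measurable_EFinP |
  move=> x _; rewrite lee_fin].
Qed.

Lemma ge0_integral_mono f g :
  measurable_fun setT f -> measurable_fun setT g ->
  (forall x, 0 <= f x) -> (forall x, f x <= g x) ->
  (\int[mu]_x (f x)%:E <= \int[mu]_x (g x)%:E)%E.
Proof.
move=> mf mg f0 fg; apply: ge0_le_integral => //;
  first [exact/measurable_EFinP | by move=> x _; rewrite lee_fin].
Qed.

(** The class of test functions: it lies in every [L^p], is stable under
    symmetric Markov operators, and generates the norm of [L^p] by duality. *)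
Definition bounded_integrable f :=
  mu.-integrable setT (EFin \o f) /\ exists M : R, forall x, `|f x| <= M.

Lemma bounded_integrable_measurable f :
  bounded_integrable f -> measurable_fun setT f.
Proof. by case=> /integrableP[/measurable_EFinP]. Qed.

Lemma le_bounded_integrable f g : measurable_fun setT g ->
  (forall x, `|g x| <= `|f x|) -> bounded_integrable f -> bounded_integrable g.
Proof.
move=> mg gf [fi [M fM]]; split; last by exists M => x; exact: le_trans (fM x).
apply: le_integrable fi => //; first by apply/measurable_EFinP.
by move=> x _; rewrite lee_fin.
Qed.

Lemma bounded_integrableB f g : bounded_integrable f -> bounded_integrable g ->
  bounded_integrable (f \- g).
Proof.
move=> [fi [M fM]] [gi [N gN]]; split.
  rewrite (_ : EFin \o (f \- g)%R = ((EFin \o f) \- (EFin \o g))%E)//.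
  exact: integrableB.
by exists (M + N) => x; apply: le_trans (ler_normB _ _) _; exact: lerD.
Qed.

Lemma bounded_integrable_powR_lty f p : 1 <= p -> bounded_integrable f ->
  (\int[mu]_x (`|f x| `^ p)%:E < +oo)%E.
Proof.
move=> p1 bf; have mf := bounded_integrable_measurable bf.
case: bf => /integrableP[_ foo] [M fM]; have p0 : 0 < p by exact: lt_le_trans p1.
apply: (@le_lt_trans _ _ (\int[mu]_x (`|M| `^ (p - 1) * `|f x|)%:E)%E).
  apply: ge0_integral_mono; try measurability.
    by move=> x; rewrite powR_ge0.
  move=> x; rewrite -(mulr_powRB1 (normr_ge0 _) p0) mulrC ler_wpM2r//.
  by rewrite ge0_ler_powR ?nnegrE ?subr_ge0// (le_trans (fM x))// ler_norm.
rewrite ge0_integral_scale ?powR_ge0//; last by measurability.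
by rewrite lte_mul_pinfty ?lee_fin ?powR_ge0.
Qed.

End nonnegative_integrals.

Section marcinkiewicz.
Context {R : realType} {d1 d2} {X : measurableType d1} {Y : measurableType d2}.
Variables (mu : {measure set X -> \bar R}) (nu : {measure set Y -> \bar R}).
Variables (T : (X -> R) -> Y -> R) (rho W : Y -> R) (A B : R).
Implicit Types (g h : X -> R) (e l q M : R) (y : Y).
Hypotheses (mrho : measurable_fun setT rho) (mW : measurable_fun setT W).
Hypotheses (rho0 : forall y, 0 <= rho y) (W0 : forall y, 0 < W y).
Hypotheses (A0 : 0 < A) (B0 : 0 <= B).
Hypothesis mT : forall g, bounded_integrable mu g -> measurable_fun setT (T g).
Hypothesis subT : forall g h, bounded_integrable mu g ->
  bounded_integrable mu h -> forall y, `|T g y| <= `|T h y| + `|T (g \- h) y|.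
Hypothesis T_Loo : forall g M, bounded_integrable mu g ->
  (forall x, `|g x| <= M) -> forall y, `|T g y| <= A * W y * M.
Hypothesis T_L2 : forall g, bounded_integrable mu g ->
  (\int[nu]_y (rho y * `|T g y| ^+ 2)%:E <=
   B%:E * \int[mu]_x (`|g x| ^+ 2)%:E)%E.

(** The estimate with all scales of [|T g| / W] below [l] left to [L^2]: this
    cutoff makes the dyadic decomposition finite. *)
Lemma marcinkiewicz_scale e l g : 0 < e -> 0 < l -> bounded_integrable mu g ->
  (\int[nu]_y (rho y * (`|T g y| `^ (2 + e) * W y `^ (- e)))%:E <=
   (l `^ e * B)%:E * \int[mu]_x (`|g x| ^+ 2)%:E +
   (4 * 2 `^ e * (2 `^ e / (2 `^ e - 1)) * (2 * A) `^ e * B)%:E *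
     \int[mu]_x (`|g x| `^ (2 + e))%:E)%E.
Proof.
move=> e0 l0 bg; have mg := bounded_integrable_measurable bg.
pose high i x := if l * 2 ^+ i < 2 * A * `|g x| then g x else 0.
have mhigh i : measurable_fun setT (high i).
  apply: measurable_fun_ifT => //; apply: measurable_fun_ltr => //.
  by measurability.
have bhigh i : bounded_integrable mu (high i).
  apply: le_bounded_integrable bg => // x; rewrite /high.
  by case: ifPn; rewrite ?normr0.
have A20 : 0 < 2 * A by rewrite mulr_gt0.
(* The cutoff defining [high] is such that, by the [L^oo] bound, the rest of [g]
   produces at most half of the scale [W y * (l * 2 ^+ i)] of [T g]. *)
have low i y : `|T (g \- high i) y| <= W y * (l * 2 ^+ i) / 2.
  have := @T_Loo (g \- high i) (l * 2 ^+ i / (2 * A)) (bounded_integrableB bg (bhigh i)).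
  move=> /(_ _ y); rewrite (_ : A * W y * _ = W y * (l * 2 ^+ i) / 2).
    apply=> x; rewrite /= /high; case: ifPn => [_|].
      by rewrite subrr normr0 divr_ge0 ?mulr_ge0 ?exprn_ge0 ?(ltW l0)// ltW.
    by rewrite -leNgt subr0 ler_pdivlMr// mulrC.
  by field; rewrite gt_eqF.
have [M gM] := bg.2.
have [n ln] : exists n, A * M / l < 2 ^+ n.
  exists (Num.bound `|A * M / l|); apply: le_lt_trans (ler_norm _) _.
  apply: lt_trans (archi_boundP (normr_ge0 _)) _.
  by rewrite -natrX ltr_nat ltn_expl.
pose c := 4 * 2 `^ e; have c0 : 0 <= c by rewrite mulr_ge0 ?powR_ge0.
have pointwise y : rho y * (`|T g y| `^ (2 + e) * W y `^ (- e)) <=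
    l `^ e * (rho y * `|T g y| ^+ 2) +
    \sum_(i < n) c * (l * 2 ^+ i) `^ e * (rho y * `|T (high i) y| ^+ 2).
  pose u := `|T g y| / W y.
  have u0 : 0 <= u by rewrite divr_ge0// ltW.
  have uh i : l * 2 ^+ i <= u -> u <= 2 * (`|T (high i) y| / W y).
    rewrite ler_pdivlMr// => lu; rewrite mulrA ler_pdivrMr// divfK ?gt_eqF//.
    have := subT bg (bhigh i) y => /le_trans/(_ (lerD (lexx _) (low i y))) h.
    have : W y * (l * 2 ^+ i) / 2 <= `|T g y| / 2.
      by rewrite ler_wpM2r// mulrC.
    by move: h; lra.
  have un : u < l * 2 ^+ n.
    rewrite mulrC -ltr_pdivrMr//; apply: le_lt_trans ln.
    rewrite ler_wpM2r ?invr_ge0 ?(ltW l0)// ler_pdivrMr//.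
    by rewrite mulrAC; exact: T_Loo.
  have := dyadic_powR_le e0 l0 u0 uh un.
  have rW : 0 <= rho y * W y ^+ 2 by rewrite mulr_ge0 ?sqr_ge0.
  move=> /(ler_wpM2l rW); rewrite mulrDr mulr_sumr.
  have Wn0 : W y != 0 by rewrite gt_eqF.
  have -> : rho y * W y ^+ 2 * (u `^ e * u ^+ 2) =
            rho y * (`|T g y| `^ (2 + e) * W y `^ (- e)).
    rewrite /u [(_ / _) `^ e]powRM ?invr_ge0 ?(ltW (W0 y))//.
    rewrite -(powR_inv1 (ltW (W0 y))) -powRrM mulN1r powR_inv1 ?(ltW (W0 y))//.
    have -> : `|T g y| `^ (2 + e) = `|T g y| `^ e * `|T g y| ^+ 2.
      rewrite -powR_mulrn// -powRD 1?addrC//.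
      by rewrite gt_eqF// addr_gt0.
    by field.
  move=> /le_trans; apply; apply: lerD.
    by rewrite le_eqVlt; apply/orP; left; apply/eqP; rewrite /u; field.
  apply: ler_sum => i _.
  by rewrite le_eqVlt; apply/orP; left; apply/eqP; rewrite /c; field.
have ci i : 0 <= c * (l * 2 ^+ i) `^ e by rewrite mulr_ge0 ?powR_ge0.
have mTg := mT bg; have mTh i := mT (bhigh i).
apply: (@le_trans _ _ (\int[nu]_y (l `^ e * (rho y * `|T g y| ^+ 2) +
    \sum_(i < n) c * (l * 2 ^+ i) `^ e * (rho y * `|T (high i) y| ^+ 2))%:E)%E).
  apply: ge0_integral_mono => //; try measurability.
  by move=> y; rewrite !mulr_ge0 ?powR_ge0.
rewrite ge0_integral_add; try measurability; last 2 first.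
- by move=> y; rewrite !mulr_ge0 ?powR_ge0 ?sqr_ge0.
- move=> y; apply: sumr_ge0 => i _.
  by rewrite mulr_ge0// mulr_ge0// sqr_ge0.
apply: leeD.
  rewrite ge0_integral_scale ?powR_ge0//; try measurability; last first.
    by move=> y; rewrite mulr_ge0 ?sqr_ge0.
  by rewrite EFinM -muleA lee_wpmul2l ?lee_fin ?powR_ge0//; exact: T_L2.
rewrite ge0_integral_bigsum; last 2 first.
- by move=> i; measurability.
- by move=> i y; rewrite mulr_ge0// mulr_ge0// sqr_ge0.
apply: (@le_trans _ _ (\sum_(i < n) (B * (c * (l * 2 ^+ i) `^ e))%:E *
    \int[mu]_x (`|high i x| ^+ 2)%:E)%E).
  apply: lee_sum => i _; rewrite ge0_integral_scale//; last 2 first.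
  - by measurability.
  - by move=> y; rewrite mulr_ge0// sqr_ge0.
  by rewrite (mulrC B) (EFinM _ B) -muleA lee_wpmul2l ?lee_fin//; exact: T_L2.
under eq_bigr => i _.
  rewrite -ge0_integral_scale; last 3 first.
  - by rewrite mulr_ge0.
  - by measurability.
  - by move=> x; rewrite sqr_ge0.
  over.
rewrite -ge0_integral_bigsum; last 2 first.
- by move=> i; measurability.
- by move=> i x; rewrite mulr_ge0 ?sqr_ge0// mulr_ge0.
have r1 : 1 < (2:R) `^ e by rewrite powR_gt1// ltr1n.
rewrite -ge0_integral_scale; last 3 first.
- by rewrite !mulr_ge0 ?powR_ge0 ?invr_ge0 ?subr_ge0// ltW.
- by measurability.
- by move=> x; rewrite powR_ge0.
apply: ge0_integral_mono; try measurability.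
  by move=> x; apply: sumr_ge0 => i _; rewrite mulr_ge0 ?sqr_ge0// mulr_ge0.
move=> x; have -> : `|g x| `^ (2 + e) = `|g x| `^ e * `|g x| ^+ 2.
  rewrite -powR_mulrn// -powRD 1?addrC//.
  by rewrite gt_eqF// addr_gt0.
have := @dyadic_sum_below _ e l (2 * A * `|g x|) n e0 l0.
rewrite mulr_ge0 ?(ltW A20)// => /(_ isT).
have cBg : 0 <= c * B * `|g x| ^+ 2 by rewrite mulr_ge0 ?sqr_ge0// mulr_ge0.
move=> /(ler_wpM2l cBg).
rewrite [X in _ <= _ * (_ * X) -> _]powRM ?(ltW A20)//.
rewrite big_mkcond mulr_sumr => h.
apply: (@le_trans _ _ (\sum_(i < n) c * B * `|g x| ^+ 2 *
   (if l * 2 ^+ i < 2 * A * `|g x| then (l * 2 ^+ i) `^ e else 0))).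
  apply: ler_sum => i _; rewrite /high; case: ifPn => _.
    by rewrite le_eqVlt; apply/orP; left; apply/eqP; ring.
  by rewrite normr0 expr0n !mulr0.
apply: (le_trans h); rewrite le_eqVlt; apply/orP; left; apply/eqP.
by rewrite /c; field; rewrite subr_eq0 gt_eqF.
Qed.

(** At the dyadic scale [l * 2 ^+ i] of [|T g| / W] only the part of [g] exceeding
    a fixed multiple of this scale matters, and it is estimated in [L^2]; the
    scales then sum to the [q]-th power. The cutoff [l] is sent to zero. *)
Lemma marcinkiewicz q g : 2 < q -> bounded_integrable mu g ->
  (\int[nu]_y (rho y * (`|T g y| `^ q * W y `^ (2 - q)))%:E <=
   (4 * 2 `^ (q - 2) * (2 `^ (q - 2) / (2 `^ (q - 2) - 1)) *
      (2 * A) `^ (q - 2) * B)%:E * \int[mu]_x (`|g x| `^ q)%:E)%E.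
Proof.
move=> q2 bg; rewrite -[2 - q]opprB; set e := q - 2; have e0 : 0 < e by rewrite subr_gt0.
have -> : q = 2 + e by rewrite /e addrC subrK.
have mg := bounded_integrable_measurable bg.
have : (\int[mu]_x (`|g x| ^+ 2)%:E < +oo)%E.
  under eq_integral => x _ do rewrite -powR_mulrn//.
  by apply: bounded_integrable_powR_lty bg; rewrite ler1n.
have : (0 <= \int[mu]_x (`|g x| ^+ 2)%:E)%E.
  by apply: integral_ge0 => x _; rewrite lee_fin sqr_ge0.
move: (fun l (lp : 0 < l) => @marcinkiewicz_scale e l g e0 lp bg).
case: (\int[mu]_x (`|g x| ^+ 2)%:E)%E => [a||]// h.
rewrite lee_fin => a0 _; apply/lee_addgt0Pr => eps eps0.
(* [l `^ e * (B * a) <= eps] *)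
pose l := (eps / (B * a + 1)) `^ e^-1.
have Ba0 : 0 < B * a + 1 by rewrite ltr_wpDl ?mulr_ge0.
have l0 : 0 < l by rewrite powR_gt0 ?divr_gt0.
apply: le_trans (h l l0) _; rewrite addeC leeD2l//.
rewrite /l -powRrM mulVf ?gt_eqF// powRr1; last by rewrite ltW// divr_gt0.
rewrite -EFinM lee_fin -mulrA mulrAC ler_pdivrMr// ler_wpM2l ?(ltW eps0)//.
by rewrite lerDl.
Qed.

End marcinkiewicz.

(** * Symmetric Markov kernels and their Dirichlet forms *)

Section Rintegral_extra.
Context {d} {T : measurableType d} {R : realType}.
Variable mu : {measure set T -> \bar R}.
Implicit Types (f g : T -> R).

Lemma dominated_integrable f g : measurable_fun setT f ->
  measurable_fun setT g -> (forall x, `|f x| <= g x) ->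
  (\int[mu]_x (g x)%:E < +oo)%E -> mu.-integrable setT (EFin \o f).
Proof.
move=> mf mg fg goo; apply/integrableP; split; first exact/measurable_EFinP.
by apply: le_lt_trans goo; apply: ge0_integral_mono => //; measurability.
Qed.

Lemma EFin_Rintegral f : mu.-integrable setT (EFin \o f) ->
  (\int[mu]_x f x)%:E = (\int[mu]_x (f x)%:E)%E.
Proof. by move=> fi; rewrite /Rintegral fineK//; exact: integrable_fin_num. Qed.

Lemma integrable_lin f g : mu.-integrable setT (EFin \o f) ->
  mu.-integrable setT (EFin \o g) -> mu.-integrable setT (EFin \o (f \+ g)).
Proof. by move=> fi gi; exact: (integrableD measurableT fi gi). Qed.

Lemma bounded_integrableM f g : bounded_integrable mu f ->
  bounded_integrable mu g -> bounded_integrable mu (f \* g).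
Proof.
move=> bf bg; have mf := bounded_integrable_measurable bf.
have mg := bounded_integrable_measurable bg.
have [M gM] := bg.2; have [/integrableP[_ foo] [N fN]] := bf.
have M0 : 0 <= M := le_trans (normr_ge0 _) (gM point).
split; last first.
  by exists (N * M) => x; rewrite /= normrM ler_pM.
apply: (@dominated_integrable _ (fun x => `|M| * `|f x|)); try measurability.
  move=> x; rewrite /= normrM mulrC ler_wpM2r// (le_trans (gM x))//.
  exact: ler_norm.
by rewrite ge0_integral_scale//; [rewrite lte_mul_pinfty|measurability].
Qed.

Lemma Rintegral4 (a b c e : T -> R) :
  mu.-integrable setT (EFin \o a) -> mu.-integrable setT (EFin \o b) ->
  mu.-integrable setT (EFin \o c) -> mu.-integrable setT (EFin \o e) ->
  \int[mu]_x ((a x + b x) - (c x + e x)) =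
  (\int[mu]_x a x + \int[mu]_x b x) - (\int[mu]_x c x + \int[mu]_x e x).
Proof.
by move=> ia ib ic ie; rewrite RintegralB// ?RintegralD//; exact: integrable_lin.
Qed.

Lemma le_norm_Rintegral f c : measurable_fun setT f ->
  (\int[mu]_x `|f x|%:E <= c%:E)%E -> `|\int[mu]_x f x| <= c.
Proof.
move=> mf fc; have fi : mu.-integrable setT (EFin \o f).
  apply/integrableP; split; first exact/measurable_EFinP.
  exact: le_lt_trans fc (ltry _).
rewrite -lee_fin EFin_normr_Rintegral//; apply: le_trans fc.
exact: le_abse_integral (measurable_int _ fi).
Qed.

End Rintegral_extra.

Section truncation.
Context {d} {T : measurableType d} {R : realType}.
Variables (mu : {measure set T -> \bar R}) (F : (set T)^nat).
Hypotheses (FT : [set: T] = \bigcup_i F i) (ndF : nondecreasing_seq F).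
Hypothesis mF : forall i, measurable (F i) /\ (mu (F i) < +oo)%E.
Implicit Types f : T -> R.

(** Truncation in height and in support, so that each truncation is both bounded
    and integrable when [F n] has finite measure. *)
Definition truncation f n x := Num.min (f x) n%:R * \1_(F n) x.

Lemma truncation_ge0 f n x : (forall x, 0 <= f x) -> 0 <= truncation f n x.
Proof. by move=> f0; rewrite mulr_ge0// le_min f0/=. Qed.

Lemma bounded_integrable_indic n : bounded_integrable mu (\1_(F n) : T -> R).
Proof.
have [mFn Foo] := mF n; split.
  have m1 : measurable_fun setT (\1_(F n) : T -> R) by exact: measurable_indic.
  apply: (@dominated_integrable _ _ _ _ _ (\1_(F n) : T -> R)) => //.
    by move=> x; rewrite ger0_norm.
  by rewrite integral_indic// setIT.
by exists 1 => x; rewrite ger0_norm// indicE lern1 leq_b1.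
Qed.

Lemma bounded_integrable_truncation f n : measurable_fun setT f ->
  (forall x, 0 <= f x) -> bounded_integrable mu (truncation f n).
Proof.
move=> mf f0; have [mFn Foo] := mF n.
have m1 : measurable_fun setT (\1_(F n) : T -> R) by exact: measurable_indic.
have fn x : `|truncation f n x| <= n%:R * \1_(F n) x.
  by rewrite ger0_norm ?truncation_ge0// ler_wpM2r// ge_min lexx orbT.
split; last first.
  by exists n%:R => x; rewrite (le_trans (fn x))// ler_piMr// indicE lern1 leq_b1.
apply: (@dominated_integrable _ _ _ _ _ (fun x => n%:R * \1_(F n) x)) => //.
- by apply: measurable_funM => //; exact: measurable_minr.
- by apply: measurable_funM.
- rewrite ge0_integral_scale// integral_indic// setIT.
  by rewrite lte_mul_pinfty.
Qed.

Lemma truncation_near f x :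
  exists N, forall n, (N <= n)%N -> truncation f n x = f x.
Proof.
have : (\bigcup_i F i) x by rewrite -FT.
case=> i _ Fix; exists (maxn i (Num.bound `|f x|)) => n.
rewrite geq_max => /andP[i_n bn]; rewrite /truncation indicE mem_set ?mulr1.
  apply/min_idPl; rewrite (le_trans (ler_norm _))//.
  by rewrite (le_trans (ltW (archi_boundP (normr_ge0 _))))// ler_nat.
by have /subsetPset := ndF i_n; exact.
Qed.

Lemma le_truncation f x m n : (forall x, 0 <= f x) -> (m <= n)%N ->
  truncation f m x <= truncation f n x.
Proof.
move=> f0 mn; rewrite /truncation ler_pM//.
- by rewrite le_min f0/=.
- by rewrite le_min ge_min lexx/= ge_min ler_nat mn orbT.
- rewrite !indicE ler_nat; case: (boolP (x \in F m)) => // xm.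
  by rewrite mem_set//; move/set_mem: xm; have /subsetPset := ndF mn; exact.
Qed.

End truncation.

Section symmetric_markov_kernel.
Context {d} {T : measurableType d} {R : realType}.
Variable mu : {sigma_finite_measure set T -> \bar R}.
Implicit Types (p : T -> T -> R) (f g h k : T -> R) (x y : T).

Definition kernel_op p f x : R := \int[mu]_y (p x y * f y).

Lemma measurable_kernel_op p f :
  measurable_fun setT (fun z : T * T => p z.1 z.2) ->
  measurable_fun setT f -> measurable_fun setT (kernel_op p f).
Proof.
move=> mp mf; pose F (z : T * T) := (p z.1 z.2 * f z.2)%:E.
have mF : measurable_fun setT F.
  apply/measurable_EFinP; apply: measurable_funM => //.
  exact: (measurableT_comp mf measurable_snd).
apply: (measurableT_comp (@fine_measurable _ _ _)) => //.
rewrite (_ : (fun x => _) = (fun x => \int[mu]_y (F^\+ (x, y)) -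
    \int[mu]_y (F^\- (x, y)))%E); last first.
  apply/funext => x; rewrite [LHS]integralE.
  by congr (_ - _)%E; apply: eq_integral => y _; rewrite ?funeposE ?funenegE.
apply: emeasurable_funB.
- apply: (measurable_fun_fubini_tonelli_F F^\+%E) => //.
  exact: measurable_funepos.
- apply: (measurable_fun_fubini_tonelli_F F^\-%E) => //.
  exact: measurable_funeneg.
Qed.

(** Symmetry is that of the operator on bounded integrable functions, as a
    symmetric semigroup on [L^2] provides it; pointwise positivity allows
    quotients of two kernels as weights. *)
Record symmetric_markov_kernel p : Prop := {
  markov_measurable : measurable_fun setT (fun z : T * T => p z.1 z.2) ;
  markov_gt0 : forall x y, 0 < p x y ;
  markov_mass : forall x, (\int[mu]_y (p x y)%:E = 1)%E ;
  markov_sym : forall f g, bounded_integrable mu f -> bounded_integrable mu g ->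
    \int[mu]_x (kernel_op p f x * g x) = \int[mu]_x (f x * kernel_op p g x) }.

Local Notation m2 := (mu \x mu)%E.

Variable p : T -> T -> R.
Hypothesis hp : symmetric_markov_kernel p.

Let mp := markov_measurable hp.
Let p0 x y : 0 <= p x y. Proof. exact: ltW (markov_gt0 hp x y). Qed.

Let mpx x : measurable_fun setT (p x).
Proof. exact: (measurableT_comp mp (measurable_pair1 x)). Qed.

Lemma kernel_op_integrable f x M : measurable_fun setT f ->
  (forall y, `|f y| <= M) -> mu.-integrable setT (fun y => (p x y * f y)%:E).
Proof.
move=> mf fM; have M0 : 0 <= M := le_trans (normr_ge0 _) (fM x).
apply: (@dominated_integrable _ _ _ _ _ (fun y => M * p x y)).
- by apply: measurable_funM.
- by apply: measurable_funM.
- by move=> y; rewrite normrM ger0_norm// mulrC ler_wpM2r.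
- by rewrite ge0_integral_scale// markov_mass// mule1 ltry.
Qed.

Lemma kernel_op_bounded f M : measurable_fun setT f ->
  (forall y, `|f y| <= M) -> forall x, `|kernel_op p f x| <= M.
Proof.
move=> mf fM x; have M0 : 0 <= M := le_trans (normr_ge0 _) (fM x).
have fi := kernel_op_integrable x mf fM.
apply: le_trans (le_normr_Rintegral measurableT fi) _.
rewrite -lee_fin EFin_Rintegral; last exact: integrable_norm.
apply: (@le_trans _ _ (\int[mu]_y (M * p x y)%:E)%E); last first.
  by rewrite ge0_integral_scale// markov_mass// mule1.
apply: ge0_integral_mono => //; try measurability.
by move=> y; rewrite normrM ger0_norm// mulrC ler_wpM2r.
Qed.

Lemma kernel_opB f g M N : measurable_fun setT f -> measurable_fun setT g ->
  (forall y, `|f y| <= M) -> (forall y, `|g y| <= N) ->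
  forall x, kernel_op p (f \- g) x = kernel_op p f x - kernel_op p g x.
Proof.
move=> mf mg fM gN x; rewrite -RintegralB//.
- by apply: eq_Rintegral => y _; rewrite mulrBr.
- exact: kernel_op_integrable fM.
- exact: kernel_op_integrable gN.
Qed.

Lemma kernel_op_cst1 x : kernel_op p (cst 1) x = 1.
Proof.
by rewrite /kernel_op /Rintegral; under eq_integral do rewrite mulr1;
  rewrite markov_mass.
Qed.

(** As each [p x] has mass one, the first marginal of the measure with density
    [p] is [mu]. *)
Lemma markov_marginal1 f : measurable_fun setT f -> (forall x, 0 <= f x) ->
  (\int[m2]_z (p z.1 z.2 * f z.1)%:E = \int[mu]_x (f x)%:E)%E.
Proof.
move=> mf f0; rewrite (fubini_tonelli1 (fun z => (p z.1 z.2 * f z.1)%:E)).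
- apply: eq_integral => x _; rewrite /fubini_F/=.
  under eq_integral do rewrite mulrC.
  by rewrite ge0_integral_scale// markov_mass// mule1.
- apply/measurable_EFinP; apply: measurable_funM => //.
  exact: (measurableT_comp mf measurable_fst).
- by move=> z; rewrite lee_fin mulr_ge0.
Qed.

Lemma kernel_op_scale c f M x : measurable_fun setT f ->
  (forall y, `|f y| <= M) ->
  (\int[mu]_y (p x y * (c * f y))%:E = (c * kernel_op p f x)%:E)%E.
Proof.
move=> mf fM; have fi := kernel_op_integrable x mf fM.
under eq_integral do rewrite mulrCA EFinM.
by rewrite integralZl// EFinM /kernel_op EFin_Rintegral.
Qed.

Let markov_sym_bounded f g : bounded_integrable mu f ->
  bounded_integrable mu g -> (forall x, 0 <= f x) -> (forall x, 0 <= g x) ->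
  (\int[m2]_z (p z.1 z.2 * (f z.1 * g z.2))%:E =
   \int[m2]_z (p z.1 z.2 * (g z.1 * f z.2))%:E)%E.
Proof.
have main h k : bounded_integrable mu h -> bounded_integrable mu k ->
    (forall x, 0 <= h x) -> (forall x, 0 <= k x) ->
    (\int[m2]_z (p z.1 z.2 * (h z.1 * k z.2))%:E =
     (\int[mu]_x (h x * kernel_op p k x))%:E)%E.
  move=> bh bk h0 k0; have mh := bounded_integrable_measurable bh.
  have mk := bounded_integrable_measurable bk.
  have [M hM] := bh.2; have [N kN] := bk.2.
  rewrite (fubini_tonelli1 (fun z => (p z.1 z.2 * (h z.1 * k z.2))%:E)); last 2 first.
  - apply/measurable_EFinP; apply: measurable_funM => //.
    by apply: measurable_funM; [exact: (measurableT_comp mh measurable_fst)|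
                                exact: (measurableT_comp mk measurable_snd)].
  - by move=> z; rewrite lee_fin !mulr_ge0.
  rewrite EFin_Rintegral; last first.
    have mkk := measurable_kernel_op mp mk; have kb := kernel_op_bounded mk kN.
    apply: (@dominated_integrable _ _ _ _ _ (fun x => N * h x)); try measurability.
    + by move=> x; rewrite normrM mulrC ler_pM// ger0_norm.
    + have [/integrableP[_ hoo] _] := bh.
      have N0 : 0 <= N := le_trans (normr_ge0 _) (kN point).
      rewrite ge0_integral_scale// lte_mul_pinfty ?lee_fin//.
      by under eq_integral do rewrite -[h _]ger0_norm//.
  by apply: eq_integral => x _; rewrite /fubini_F/= (kernel_op_scale _ _ mk kN).
move=> bf bg f0 g0; rewrite (main _ _ bf bg f0 g0) (main _ _ bg bf g0 f0).
congr EFin.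
rewrite -(markov_sym hp bf bg).
by apply: eq_Rintegral => x _; rewrite mulrC.
Qed.

(** The measure with density [p] is symmetric on products; the bounded case is
    extended by monotone convergence. *)
Lemma markov_sym_ge0 f g : measurable_fun setT f -> measurable_fun setT g ->
  (forall x, 0 <= f x) -> (forall x, 0 <= g x) ->
  (\int[m2]_z (p z.1 z.2 * (f z.1 * g z.2))%:E =
   \int[m2]_z (p z.1 z.2 * (g z.1 * f z.2))%:E)%E.
Proof.
move=> mf mg f0 g0.
have [F [FT ndF mF]] := (sigma_finiteP setT mu).1 (@sigma_finiteT _ _ _ mu).
pose trunc f n := truncation F f n.
have trunc_ge0 h n x : (forall x, 0 <= h x) -> 0 <= trunc h n x.
  exact: truncation_ge0.
have bt h n : measurable_fun setT h -> (forall x, 0 <= h x) ->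
    bounded_integrable mu (trunc h n).
  by move=> mh h0; exact: bounded_integrable_truncation.
have main h k : measurable_fun setT h -> measurable_fun setT k ->
    (forall x, 0 <= h x) -> (forall x, 0 <= k x) ->
    (\int[m2]_z (p z.1 z.2 * (h z.1 * k z.2))%:E = limn (fun n =>
     \int[m2]_z (p z.1 z.2 * (trunc h n z.1 * trunc k n z.2))%:E))%E.
  move=> mh mk h0 k0; rewrite -monotone_convergence//.
  - apply: eq_integral => z _; apply/esym/lim_near_cst => //.
    have [N1 hN1] := truncation_near FT ndF h z.1.
    have [N2 hN2] := truncation_near FT ndF k z.2.
    exists (maxn N1 N2) => // n /=; rewrite geq_max => /andP[/hN1 + /hN2].
    by rewrite /trunc => -> ->.
  - move=> n; have mhn := bounded_integrable_measurable (bt h n mh h0).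
    have mkn := bounded_integrable_measurable (bt k n mk k0).
    apply/measurable_EFinP; apply: measurable_funM => //.
    by apply: measurable_funM; [exact: (measurableT_comp mhn measurable_fst)|
                                exact: (measurableT_comp mkn measurable_snd)].
  - by move=> n z _; rewrite lee_fin mulr_ge0// mulr_ge0 ?trunc_ge0.
  - move=> z _ m n mn; rewrite lee_fin ler_wpM2l// ler_pM ?trunc_ge0//;
      exact: le_truncation.
rewrite (main _ _ mf mg f0 g0) (main _ _ mg mf g0 f0); congr (limn _).
apply/funext => n; apply: markov_sym_bounded => [||x|x];
  by [exact: bt|exact: trunc_ge0].
Qed.

Lemma markov_marginal2 f : measurable_fun setT f -> (forall x, 0 <= f x) ->
  (\int[m2]_z (p z.1 z.2 * f z.2)%:E = \int[mu]_x (f x)%:E)%E.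
Proof.
move=> mf f0; rewrite -markov_marginal1//.
have := @markov_sym_ge0 f (cst 1) mf _ f0 (fun=> ler01).
under eq_integral do rewrite mulr1.
move=> ->//; apply: eq_integral => z _; congr (_ * _)%:E.
by rewrite mul1r.
Qed.

End symmetric_markov_kernel.
Section markov_form.
Context {d} {T : measurableType d} {R : realType}.
Variable mu : {sigma_finite_measure set T -> \bar R}.
Implicit Types (f g h k : T -> R) (x y : T).

Local Notation m2 := (mu \x mu)%E.

Variable p : T -> T -> R.
Hypothesis hp : symmetric_markov_kernel mu p.

Let mp := markov_measurable hp.
Let p0 x y : 0 <= p x y. Proof. exact: ltW (markov_gt0 hp x y). Qed.

Let measurable_1 f : measurable_fun setT f ->
  measurable_fun setT (fun z : T * T => f z.1).
Proof. by move=> mf; exact: (measurableT_comp mf measurable_fst). Qed.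

Let measurable_2 f : measurable_fun setT f ->
  measurable_fun setT (fun z : T * T => f z.2).
Proof. by move=> mf; exact: (measurableT_comp mf measurable_snd). Qed.

Let measurable_12 f g : measurable_fun setT f -> measurable_fun setT g ->
  measurable_fun setT (fun z : T * T => p z.1 z.2 * (f z.1 * g z.2)).
Proof.
move=> mf mg; apply: measurable_funM => //.
by apply: measurable_funM; [exact: measurable_1|exact: measurable_2].
Qed.

(* Positive and negative parts, written so that their properties are algebraic
   in [f x] and its norm. *)
Let posp f x := 2^-1 * (`|f x| + f x).
Let negp f x := 2^-1 * (`|f x| - f x).

Let half_ge0 : 0 <= 2^-1 :> R. Proof. by rewrite invr_ge0. Qed.

Let posp_ge0 f x : 0 <= posp f x.
Proof. by rewrite mulr_ge0// -lerBlDr sub0r -normrN ler_norm. Qed.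

Let negp_ge0 f x : 0 <= negp f x.
Proof. by rewrite mulr_ge0// subr_ge0 ler_norm. Qed.

Let posp_le f x : posp f x <= `|f x|.
Proof. by rewrite /posp; have := ler_norm (f x); lra. Qed.

Let negp_le f x : negp f x <= `|f x|.
Proof. by rewrite /negp; have := ler_norm (- f x); rewrite normrN; lra. Qed.

Let measurable_posp f : measurable_fun setT f -> measurable_fun setT (posp f).
Proof. by move=> mf; rewrite /posp; measurability. Qed.

Let measurable_negp f : measurable_fun setT f -> measurable_fun setT (negp f).
Proof. by move=> mf; rewrite /negp; measurability. Qed.

Let posnegE f x : f x = posp f x - negp f x.
Proof. by rewrite /posp /negp; field. Qed.

(** Signed version of the symmetry, by splitting into positive and negative
    parts. *)
Lemma markov_sym_integrable f g :
  measurable_fun setT f -> measurable_fun setT g ->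
  (\int[m2]_z (p z.1 z.2 * (`|f z.1| * `|g z.2|))%:E < +oo)%E ->
  \int[m2]_z (p z.1 z.2 * (f z.1 * g z.2)) =
  \int[m2]_z (p z.1 z.2 * (g z.1 * f z.2)).
Proof.
move=> mf mg fgoo.
have mnf : measurable_fun setT (fun x => `|f x|) by measurability.
have mng : measurable_fun setT (fun x => `|g x|) by measurability.
have gfoo : (\int[m2]_z (p z.1 z.2 * (`|g z.1| * `|f z.2|))%:E < +oo)%E.
  by have /= <- := markov_sym_ge0 hp mnf mng (fun=> normr_ge0 _) (fun=> normr_ge0 _).
have intr (a b : T -> R) (ma : measurable_fun setT (fun x => `|a x|))
    (mb : measurable_fun setT (fun x => `|b x|))
    (aboo : (\int[m2]_z (p z.1 z.2 * (`|a z.1| * `|b z.2|))%:E < +oo)%E)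
    (h k : T -> R) :
    measurable_fun setT h -> measurable_fun setT k ->
    (forall x, 0 <= h x <= `|a x|) -> (forall x, 0 <= k x <= `|b x|) ->
    m2.-integrable setT (EFin \o (fun z : T * T => p z.1 z.2 * (h z.1 * k z.2))).
  move=> mh mk ha kb.
  apply: (@dominated_integrable _ _ _ _ _
    (fun z => p z.1 z.2 * (`|a z.1| * `|b z.2|))) => //.
  - exact: measurable_12.
  - exact: (measurable_12 ma mb).
  move=> z; have /andP[h0 ha1] := ha z.1; have /andP[k0 kb1] := kb z.2.
  by rewrite ger0_norm ?mulr_ge0// ler_wpM2l// ler_pM.
have pf x : 0 <= posp f x <= `|f x| by rewrite posp_ge0 posp_le.
have nf x : 0 <= negp f x <= `|f x| by rewrite negp_ge0 negp_le.
have pg x : 0 <= posp g x <= `|g x| by rewrite posp_ge0 posp_le.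
have ng x : 0 <= negp g x <= `|g x| by rewrite negp_ge0 negp_le.
have mpf := measurable_posp mf; have mnnf := measurable_negp mf.
have mpg := measurable_posp mg; have mnng := measurable_negp mg.
have split4 h k z : p z.1 z.2 * (h z.1 * k z.2) =
    (p z.1 z.2 * (posp h z.1 * posp k z.2) + p z.1 z.2 * (negp h z.1 * negp k z.2)) -
    (p z.1 z.2 * (posp h z.1 * negp k z.2) + p z.1 z.2 * (negp h z.1 * posp k z.2)).
  by rewrite (posnegE h) (posnegE k); ring.
under eq_Rintegral do rewrite split4.
under [RHS]eq_Rintegral do rewrite split4.
have fgi := intr f g mnf mng fgoo.
have gfi := intr g f mng mnf gfoo.
rewrite (Rintegral4 (fgi _ _ mpf mpg pf pg) (fgi _ _ mnnf mnng nf ng)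
                    (fgi _ _ mpf mnng pf ng) (fgi _ _ mnnf mpg nf pg)).
rewrite (Rintegral4 (gfi _ _ mpg mpf pg pf) (gfi _ _ mnng mnnf ng nf)
                    (gfi _ _ mpg mnnf pg nf) (gfi _ _ mnng mpf ng pf)).
rewrite [X in _ - X = _]addrC.
by congr ((_ + _) - (_ + _)); congr fine; exact: markov_sym_ge0.
Qed.

Let markov_marginal_integrable h : measurable_fun setT h ->
  mu.-integrable setT (EFin \o h) ->
  [/\ m2.-integrable setT (EFin \o (fun z => p z.1 z.2 * h z.1)),
      m2.-integrable setT (EFin \o (fun z => p z.1 z.2 * h z.2)),
      \int[m2]_z (p z.1 z.2 * h z.1) = \int[mu]_x h x &
      \int[m2]_z (p z.1 z.2 * h z.2) = \int[mu]_x h x].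
Proof.
move=> mh /[dup] ih /integrableP[_ hoo].
have mnh : measurable_fun setT (fun x => `|h x|) by measurability.
have m1 : measurable_fun setT (fun z : T * T => p z.1 z.2 * h z.1).
  by apply: measurable_funM => //; exact: measurable_1.
have m2' : measurable_fun setT (fun z : T * T => p z.1 z.2 * h z.2).
  by apply: measurable_funM => //; exact: measurable_2.
have i1 : m2.-integrable setT (EFin \o (fun z => p z.1 z.2 * h z.1)).
  apply: (@dominated_integrable _ _ _ _ _ (fun z => p z.1 z.2 * `|h z.1|)) => //.
  - by apply: measurable_funM => //; exact: (measurable_1 mnh).
  - by move=> z; rewrite normrM ger0_norm.
  - by rewrite (markov_marginal1 hp mnh).
have i2 : m2.-integrable setT (EFin \o (fun z => p z.1 z.2 * h z.2)).
  apply: (@dominated_integrable _ _ _ _ _ (fun z => p z.1 z.2 * `|h z.2|)) => //.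
  - by apply: measurable_funM => //; exact: (measurable_2 mnh).
  - by move=> z; rewrite normrM ger0_norm.
  - by rewrite (markov_marginal2 hp mnh).
have e1 : \int[m2]_z (p z.1 z.2 * h z.1) = \int[mu]_x h x.
  congr fine; rewrite -(integral12_prod_meas1 i1); apply: eq_integral => x _.
  rewrite /fubini_F/=.
  have c1 (y : T) : `|cst 1 y| <= 1 :> R by rewrite normr1.
  have mc : measurable_fun setT (cst 1 : T -> R) by [].
  have := kernel_op_scale hp (h x) x mc c1.
  rewrite kernel_op_cst1// mulr1 => <-.
  by [].
split => //; rewrite -e1.
have mc : measurable_fun setT (cst 1 : T -> R) by [].
have := markov_sym_integrable mc mh.
under eq_integral do rewrite normr1 mul1r.
rewrite (markov_marginal2 hp mnh)// => /(_ hoo).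
by under eq_Rintegral do rewrite mul1r; move=> ->; apply: eq_Rintegral => z _;
  rewrite mulr1.
Qed.

Section pairing.
Variables (r : R) (f g : T -> R).
Hypotheses (r1 : 1 <= r) (mf : measurable_fun setT f).
Hypothesis foo : (\int[mu]_x (`|f x| `^ r)%:E < +oo)%E.
Hypothesis bg : bounded_integrable mu g.

Let mg := bounded_integrable_measurable bg.

(* A crude form of Young's inequality, which treats all exponents [r >= 1] at
   once since [g] is bounded. *)
Let young M x y : (forall x, `|g x| <= M) ->
  `|f x| * `|g y| <= M * `|f x| `^ r + `|g y|.
Proof.
move=> gM; have [f1|f1] := leP `|f x| 1.
  rewrite (@le_trans _ _ `|g y|) ?ler_piMl// lerDr mulr_ge0 ?powR_ge0//.
  exact: le_trans (gM x).
rewrite (@le_trans _ _ (M * `|f x| `^ r))// ?lerDl// mulrC ler_pM//.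
by rewrite le1r_powR// ltW.
Qed.

Let goo : (\int[mu]_x `|g x|%:E < +oo)%E.
Proof. by have [/integrableP[]] := bg. Qed.

Let mfr : measurable_fun setT (fun x => `|f x| `^ r).
Proof. by measurability. Qed.

Let mng : measurable_fun setT (fun x => `|g x|).
Proof. by measurability. Qed.

Let mnf : measurable_fun setT (fun x => `|f x|).
Proof. by measurability. Qed.

Lemma markov_pairing_lty :
  (\int[m2]_z (p z.1 z.2 * (`|f z.1| * `|g z.2|))%:E < +oo)%E.
Proof.
have [M gM] := bg.2; have M0 : 0 <= M := le_trans (normr_ge0 _) (gM point).
apply: (@le_lt_trans _ _ (\int[m2]_z (M * (p z.1 z.2 * `|f z.1| `^ r) +
    p z.1 z.2 * `|g z.2|)%:E)%E).
  apply: ge0_integral_mono => [||z|z].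
  - exact: (measurable_12 mnf mng).
  - apply: measurable_funD.
      apply: measurable_funM => //; apply: measurable_funM => //.
      exact: (measurable_1 mfr).
    by apply: measurable_funM => //; exact: (measurable_2 mng).
  - by rewrite !mulr_ge0.
  - by rewrite (mulrCA M) -mulrDr ler_wpM2l// young.
rewrite ge0_integral_add; last 4 first.
- apply: measurable_funM => //; apply: measurable_funM => //.
  exact: (measurable_1 mfr).
- by apply: measurable_funM => //; exact: (measurable_2 mng).
- by move=> z; rewrite !mulr_ge0 ?powR_ge0.
- by move=> z; rewrite mulr_ge0.
rewrite ge0_integral_scale//; last 2 first.
- by apply: measurable_funM => //; exact: (measurable_1 mfr).
- by move=> z; rewrite mulr_ge0 ?powR_ge0.
rewrite (markov_marginal1 hp mfr)//.
by rewrite (markov_marginal2 hp mng)// lte_add_pinfty// lte_mul_pinfty.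
Qed.

Lemma pairing_integrable : mu.-integrable setT (EFin \o (f \* g)).
Proof.
have [M gM] := bg.2; have M0 : 0 <= M := le_trans (normr_ge0 _) (gM point).
apply: (@dominated_integrable _ _ _ _ _ (fun x => M * `|f x| `^ r + `|g x|)).
- exact: measurable_funM.
- by measurability.
- by move=> x; rewrite normrM young.
rewrite ge0_integral_add//; last 2 first.
- by measurability.
- by move=> x; rewrite mulr_ge0 ?powR_ge0.
by rewrite ge0_integral_scale// lte_add_pinfty// lte_mul_pinfty.
Qed.

Let integrable_12 :
  m2.-integrable setT (EFin \o (fun z => p z.1 z.2 * (f z.1 * g z.2))).
Proof.
apply: dominated_integrable markov_pairing_lty.
- exact: measurable_12.
- exact: (measurable_12 mnf mng).
by move=> z; rewrite normrM ger0_norm// ler_wpM2l// normrM.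
Qed.

Let integrable_21 :
  m2.-integrable setT (EFin \o (fun z => p z.1 z.2 * (g z.1 * f z.2))).
Proof.
have oo : (\int[m2]_z (p z.1 z.2 * (`|g z.1| * `|f z.2|))%:E < +oo)%E.
  have /= <- := markov_sym_ge0 hp mnf mng (fun=> normr_ge0 _) (fun=> normr_ge0 _).
  exact: markov_pairing_lty.
apply: dominated_integrable oo.
- exact: measurable_12.
- exact: (measurable_12 mng mnf).
by move=> z; rewrite normrM ger0_norm// ler_wpM2l// normrM.
Qed.

Lemma markov_pairing_kernel_op :
  \int[mu]_x (f x * kernel_op mu p g x) =
  \int[m2]_z (p z.1 z.2 * (f z.1 * g z.2)).
Proof.
congr fine; rewrite -(integral12_prod_meas1 integrable_12).
have [M gM] := bg.2.
by apply: eq_integral => x _; rewrite /fubini_F/= (kernel_op_scale hp _ _ mg gM).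
Qed.

(** The operator of the kernel need not be defined by a convergent integral at
    every point when [f] is unbounded, only at almost every point where [g]
    does not vanish. *)
Lemma markov_pairing_kernel_op_ae :
  \int[m2]_z (p z.1 z.2 * (g z.1 * f z.2)) =
    \int[mu]_x (kernel_op mu p f x * g x) /\
  mu.-integrable setT (EFin \o (kernel_op mu p f \* g)).
Proof.
have ae1 : {ae mu, forall x, setT x ->
    fubini_F mu (EFin \o (fun z => p z.1 z.2 * (g z.1 * f z.2))) x =
    (kernel_op mu p f x * g x)%:E}.
  have := ae_integrable1 integrable_21; apply: filterS => x /= ix _.
  rewrite /fubini_F/=; have [g0|g0] := eqVneq (g x) 0.
    under eq_integral do rewrite g0 mul0r mulr0.
    by rewrite integral0 g0 mulr0.
  have ipf : mu.-integrable setT (fun y => (p x y * f y)%:E).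
    have := integrableZl measurableT (g x)^-1 ix.
    apply: eq_integrable => // y _; rewrite -EFinM; congr EFin.
    by rewrite /=; field.
  under eq_integral do rewrite mulrCA mulrC EFinM.
  by rewrite integralZr// EFinM /kernel_op EFin_Rintegral.
have mkg : measurable_fun setT (kernel_op mu p f \* g).
  by apply: measurable_funM => //; exact: measurable_kernel_op (markov_measurable hp) _.
have iF := integrable_fubini_F integrable_21.
split.
  congr fine; rewrite -(integral12_prod_meas1 integrable_21).
  apply: ae_eq_integral => //; first by apply: measurable_int iF.
  exact/measurable_EFinP.
apply/integrableP; split; first exact/measurable_EFinP.
have /integrableP[mF Foo] := iF.
rewrite (_ : (\int[mu]_x _ = \int[mu]_x `|fubini_F mu
    (EFin \o (fun z => p z.1 z.2 * (g z.1 * f z.2))%R) x|)%E)//.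
apply: ae_eq_integral => //.
- by apply: measurableT_comp => //; exact/measurable_EFinP.
- exact: measurableT_comp.
- by apply: filterS ae1 => x h Tx; rewrite h.
Qed.

Lemma kernel_op_selfadjoint :
  \int[mu]_x ((kernel_op mu p f x - f x) * g x) =
  \int[mu]_x (f x * (kernel_op mu p g x - g x)).
Proof.
have [E iE] := markov_pairing_kernel_op_ae.
under eq_Rintegral do rewrite mulrBl.
rewrite RintegralB//; last exact: pairing_integrable.
under [RHS]eq_Rintegral do rewrite mulrBr.
rewrite RintegralB//; last exact: pairing_integrable.
  by rewrite markov_pairing_kernel_op markov_sym_integrable ?E// markov_pairing_lty.
have := integrable_fubini_F integrable_12; apply: eq_integrable => // x _.
have [M gM] := bg.2.
by rewrite /fubini_F/= (kernel_op_scale hp _ _ mg gM).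
Qed.

(** The approximating Dirichlet form: both marginals of the measure with density
    [p] are [mu], so the products of [f] and [g] at the same point integrate to
    the pairing of [f] and [g], and the mixed ones to that of [f] and [P g]. *)
Lemma kernel_op_increment :
  \int[mu]_x (f x * (kernel_op mu p g x - g x)) =
  - 2^-1 * \int[m2]_z (p z.1 z.2 * ((f z.1 - f z.2) * (g z.1 - g z.2))).
Proof.
have ifg := pairing_integrable.
have [i1 i2 e1 e2] := markov_marginal_integrable (measurable_funM mf mg) ifg.
have -> : \int[m2]_z (p z.1 z.2 * ((f z.1 - f z.2) * (g z.1 - g z.2))) =
    \int[m2]_z ((p z.1 z.2 * (f \* g) z.1 + p z.1 z.2 * (f \* g) z.2) -
      (p z.1 z.2 * (f z.1 * g z.2) + p z.1 z.2 * (g z.1 * f z.2))).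
  by apply: eq_Rintegral => z _ /=; ring.
rewrite Rintegral4// e1 e2 -(markov_sym_integrable mf mg markov_pairing_lty).
under eq_Rintegral do rewrite mulrBr.
rewrite RintegralB//; last first.
  have := integrable_fubini_F integrable_12; apply: eq_integrable => // x _.
  have [M gM] := bg.2.
  by rewrite /fubini_F/= (kernel_op_scale hp _ _ mg gM).
by rewrite markov_pairing_kernel_op /=; field.
Qed.

End pairing.

Lemma bounded_integrable_kernel_op g : bounded_integrable mu g ->
  bounded_integrable mu (kernel_op mu p g).
Proof.
move=> bg; have mg := bounded_integrable_measurable bg.
have [M gM] := bg.2; split; last first.
  by exists M; exact: (kernel_op_bounded hp mg gM).
have [ig _] := bg.
have iz : m2.-integrable setT (EFin \o (fun z => p z.1 z.2 * g z.2)).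
  by have [] := markov_marginal_integrable mg ig.
have := integrable_fubini_F iz; apply: eq_integrable => // x _.
by rewrite /fubini_F/= /kernel_op EFin_Rintegral//; exact: kernel_op_integrable gM.
Qed.

End markov_form.

(** * Energy decay along a symmetric Markov semigroup *)

Section convex_sequence.
Context {R : realType}.

(** The decrements of a convex sequence decrease, and the first [n.+1] of them
    sum to [a 0 - a n.+1]. *)
Lemma convex_decrement_le (a : nat -> R) n : (forall k, 0 <= a k) ->
  (forall k, 0 <= (a k + a k.+2) - (a k.+1 + a k.+1)) ->
  n.+1%:R * (a n - a n.+1) <= a 0%N.
Proof.
move=> a0 ac; suff : n.+1%:R * (a n - a n.+1) <= a 0%N - a n.+1.
  by move/le_trans; apply; rewrite lerBlDr lerDl.
elim: n => [|n IH]; first by rewrite mul1r.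
rewrite -natr1 mulrDl mul1r.
have : n.+1%:R * (a n.+1 - a n.+2) <= n.+1%:R * (a n - a n.+1).
  by rewrite ler_wpM2l//; have := ac n; lra.
by move/le_trans => /(_ _ IH); lra.
Qed.

End convex_sequence.

Section markov_semigroup.
Context {d} {T : measurableType d} {R : realType}.
Variable mu : {sigma_finite_measure set T -> \bar R}.
Implicit Types (pt : R -> T -> T -> R) (f g h : T -> R) (x y : T) (s t : R).

Local Notation m2 := (mu \x mu)%E.

Record symmetric_markov_semigroup pt : Prop := {
  semigroup_kernel : forall t, 0 < t -> symmetric_markov_kernel mu (pt t) ;
  semigroup_add : forall s t g, 0 < s -> 0 < t -> bounded_integrable mu g ->
    kernel_op mu (pt (s + t)) g =
    kernel_op mu (pt s) (kernel_op mu (pt t) g) %[ae mu] }.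

Variable pt : R -> T -> T -> R.
Hypothesis hpt : symmetric_markov_semigroup pt.

Local Notation P t := (kernel_op mu (pt t)).

Lemma semigroup_bounded_integrable t g : 0 < t -> bounded_integrable mu g ->
  bounded_integrable mu (P t g).
Proof.
by move=> t0; exact: (bounded_integrable_kernel_op (semigroup_kernel hpt t0)).
Qed.

Let ae_eq_Rintegral f g : measurable_fun setT f -> measurable_fun setT g ->
  f = g %[ae mu] -> \int[mu]_x f x = \int[mu]_x g x.
Proof.
move=> mf mg fg; congr fine; apply: ae_eq_integral => //.
- exact/measurable_EFinP.
- exact/measurable_EFinP.
- by apply: filterS fg => x + Tx => ->.
Qed.

Definition energy g t := \int[mu]_x (g x * P t g x).

Lemma semigroup_inner s t g : 0 < s -> 0 < t -> bounded_integrable mu g ->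
  \int[mu]_x (P s g x * P t g x) = energy g (s + t).
Proof.
move=> s0 t0 bg; have bPt := semigroup_bounded_integrable t0 bg.
rewrite (markov_sym (semigroup_kernel hpt s0) bg bPt).
have mg := bounded_integrable_measurable bg.
apply: ae_eq_Rintegral.
- apply: measurable_funM => //.
  apply: (measurable_kernel_op _ (markov_measurable (semigroup_kernel hpt s0))).
  exact: bounded_integrable_measurable bPt.
- apply: measurable_funM => //.
  exact: (measurable_kernel_op _ (markov_measurable (semigroup_kernel hpt (addr_gt0 s0 t0)))).
- by apply: filterS (semigroup_add hpt s0 t0 bg) => x ->.
Qed.

Let inner_sqrB f g : bounded_integrable mu f -> bounded_integrable mu g ->
  0 <= (\int[mu]_x (f x * f x) + \int[mu]_x (g x * g x)) -
       (\int[mu]_x (f x * g x) + \int[mu]_x (f x * g x)).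
Proof.
move=> bf bg; have i a b : bounded_integrable mu a -> bounded_integrable mu b ->
    mu.-integrable setT (EFin \o (a \* b)).
  by move=> ba bb; have [] := bounded_integrableM ba bb.
rewrite -(Rintegral4 (i _ _ bf bf) (i _ _ bg bg) (i _ _ bf bg) (i _ _ bf bg)).
apply: Rintegral_ge0 => x _ /=.
by rewrite (_ : _ - _ = (f x - g x) ^+ 2) ?sqr_ge0//; ring.
Qed.

Lemma energy_convex0 t g : 0 < t -> bounded_integrable mu g ->
  0 <= (\int[mu]_x (g x * g x) + energy g (t + t)) - (energy g t + energy g t).
Proof.
move=> t0 bg; rewrite -(semigroup_inner t0 t0 bg).
exact: (inner_sqrB bg (semigroup_bounded_integrable t0 bg)).
Qed.

(** Writing [2 * s] as a double time step makes the second difference of the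
    energy the square of an [L^2] norm. *)
Lemma energy_convex s t g : 0 < s -> 0 < t -> bounded_integrable mu g ->
  0 <= (energy g (s + s) + energy g ((s + t) + (s + t))) -
       (energy g (s + (s + t)) + energy g (s + (s + t))).
Proof.
move=> s0 t0 bg; have st0 : 0 < s + t by rewrite addr_gt0.
rewrite -!semigroup_inner//.
exact: (inner_sqrB (semigroup_bounded_integrable s0 bg)
                   (semigroup_bounded_integrable st0 bg)).
Qed.

Lemma energy_ge0 t g : 0 < t -> bounded_integrable mu g -> 0 <= energy g t.
Proof.
move=> t0 bg; have t20 : 0 < t / 2 by rewrite divr_gt0.
rewrite (splitr t) -semigroup_inner//; apply: Rintegral_ge0 => x _.
by rewrite -expr2 sqr_ge0.
Qed.

Lemma energy_decrement_le t g n : 0 < t -> bounded_integrable mu g ->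
  n.+2%:R * (energy g (n.+1%:R * t) - energy g (n.+2%:R * t)) <=
  \int[mu]_x (g x * g x).
Proof.
move=> t0 bg.
pose a k := if k is 0%N then \int[mu]_x (g x * g x) else energy g (k%:R * t).
apply: (@convex_decrement_le _ a n.+1) => k.
  case: k => [|k] /=; last by apply: energy_ge0 => //; rewrite mulr_gt0.
  by apply: Rintegral_ge0 => x _; rewrite -expr2 sqr_ge0.
case: k => [|k] /=.
  have := energy_convex0 t0 bg.
  by rewrite mul1r (_ : 2 * t = t + t)//; ring.
pose s := k.+1%:R * t / 2; have s0 : 0 < s by rewrite divr_gt0// mulr_gt0.
have -> : k.+1%:R * t = s + s by rewrite /s -splitr.
have -> : k.+2%:R * t = s + (s + t).
  by rewrite addrA /s -splitr -natr1 mulrDl mul1r.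
have -> : k.+3%:R * t = (s + t) + (s + t).
  by rewrite addrACA /s -splitr -!natr1 !mulrDl !mul1r addrA.
exact: energy_convex.
Qed.

Local Notation incr g := (fun z : T * T => g z.1 - g z.2).

Let measurable_incr g : measurable_fun setT g ->
  measurable_fun setT (incr g).
Proof.
by move=> mg; apply: measurable_funB;
  [exact: (measurableT_comp mg measurable_fst) |
   exact: (measurableT_comp mg measurable_snd)].
Qed.

Let pt_ge0 t x y : 0 < t -> 0 <= pt t x y.
Proof. by move=> t0; exact: ltW (markov_gt0 (semigroup_kernel hpt t0) x y). Qed.

Let measurable_pt t : 0 < t ->
  measurable_fun setT (fun z : T * T => pt t z.1 z.2).
Proof. by move=> t0; exact: markov_measurable (semigroup_kernel hpt t0). Qed.

Let normB_powR (a b q : R) : 1 <= q ->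
  `|a - b| `^ q <= 2 `^ q * `|a| `^ q + 2 `^ q * `|b| `^ q.
Proof.
move=> q1; have q0 : 0 <= q by rewrite (le_trans _ q1).
rewrite -!powRM//; have [ab|ba] := leP `|a| `|b|.
  rewrite (@le_trans _ _ ((2 * `|b|) `^ q)) ?lerDr ?powR_ge0//.
  rewrite ge0_ler_powR ?nnegrE ?mulr_ge0//.
  by rewrite (le_trans (ler_normB _ _))// mulr_natl mulr2n lerD2r.
rewrite (@le_trans _ _ ((2 * `|a|) `^ q)) ?lerDl ?powR_ge0//.
rewrite ge0_ler_powR ?nnegrE ?mulr_ge0//.
by rewrite (le_trans (ler_normB _ _))// mulr_natl mulr2n lerD2l ltW.
Qed.

Lemma markov_incr_powR_le t g q : 0 < t -> 1 <= q -> measurable_fun setT g ->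
  (\int[m2]_z (pt t z.1 z.2 * `|g z.1 - g z.2| `^ q)%:E <=
   (2 * 2 `^ q)%:E * \int[mu]_x (`|g x| `^ q)%:E)%E.
Proof.
move=> t0 q1 mg; have mgq : measurable_fun setT (fun x => `|g x| `^ q).
  by measurability.
have mgq1 : measurable_fun setT (fun z : T * T => `|g z.1| `^ q).
  exact: (measurableT_comp mgq measurable_fst).
have mgq2 : measurable_fun setT (fun z : T * T => `|g z.2| `^ q).
  exact: (measurableT_comp mgq measurable_snd).
have mi := measurable_incr mg; have mp := measurable_pt t0.
apply: (@le_trans _ _ (\int[m2]_z (2 `^ q * (pt t z.1 z.2 * `|g z.1| `^ q) +
    2 `^ q * (pt t z.1 z.2 * `|g z.2| `^ q))%:E)%E).
  apply: ge0_integral_mono => [||z|z].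
  - apply: measurable_funM => //.
    apply: (measurableT_comp (@measurable_powR _ _)).
    exact: (measurableT_comp (@normr_measurable _ setT)).
  - apply: measurable_funD; apply: measurable_funM => //; exact: measurable_funM.
  - by rewrite mulr_ge0 ?pt_ge0 ?powR_ge0.
  - rewrite mulrCA (mulrCA (2 `^ q)) -mulrDr ler_wpM2l ?pt_ge0//.
    exact: normB_powR.
rewrite ge0_integral_add; last 4 first.
- by apply: measurable_funM => //; exact: measurable_funM.
- by apply: measurable_funM => //; exact: measurable_funM.
- by move=> z; rewrite !mulr_ge0 ?powR_ge0 ?pt_ge0.
- by move=> z; rewrite !mulr_ge0 ?powR_ge0 ?pt_ge0.
have pq0 (u : T * T -> R) z : 0 <= pt t z.1 z.2 * `|u z| `^ q.
  by rewrite mulr_ge0 ?powR_ge0 ?pt_ge0.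
rewrite !ge0_integral_scale ?powR_ge0//; try exact: measurable_funM; last 2 first.
- by move=> z; rewrite mulr_ge0 ?powR_ge0 ?pt_ge0.
- by move=> z; rewrite mulr_ge0 ?powR_ge0 ?pt_ge0.
rewrite (markov_marginal1 (semigroup_kernel hpt t0) mgq); last first.
  by move=> x; rewrite powR_ge0.
rewrite (markov_marginal2 (semigroup_kernel hpt t0) mgq); last first.
  by move=> x; rewrite powR_ge0.
rewrite -ge0_muleDl ?lee_fin ?powR_ge0// -EFinD.
by rewrite (_ : 2 `^ q + 2 `^ q = 2 * 2 `^ q)//; ring.
Qed.

(** With [s = n.+1 * t], the left-hand side is twice the decrement of the convex
    function [energy g] from [2 * s] to [2 * s + t]. *)
Lemma semigroup_form_decay t g n : 0 < t -> bounded_integrable mu g ->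
  (\int[m2]_z (pt t z.1 z.2 *
     `|P (n.+1%:R * t) g z.1 - P (n.+1%:R * t) g z.2| ^+ 2)%:E <=
   n.+1%:R^-1%:E * \int[mu]_x (`|g x| ^+ 2)%:E)%E.
Proof.
move=> t0 bg; set s := n.+1%:R * t; have s0 : 0 < s by rewrite mulr_gt0.
pose u := P s g; have bu := semigroup_bounded_integrable s0 bg.
have mu_ := bounded_integrable_measurable bu.
have hp := semigroup_kernel hpt t0.
have uoo := bounded_integrable_powR_lty (ler1n _ 2) bu.
have ii : m2.-integrable setT (EFin \o
    (fun z => pt t z.1 z.2 * ((u z.1 - u z.2) * (u z.1 - u z.2)))).
  have h2 := markov_incr_powR_le t0 (ler1n _ 2) mu_.
  apply: (@dominated_integrable _ _ _ _ _
    (fun z => pt t z.1 z.2 * `|u z.1 - u z.2| `^ 2%:R)).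
  - apply: measurable_funM; first exact: measurable_pt.
    by apply: measurable_funM; exact: measurable_incr.
  - apply: measurable_funM; first exact: measurable_pt.
    apply: (measurableT_comp (@measurable_powR _ _)).
    by apply: (measurableT_comp (@normr_measurable _ setT)); exact: measurable_incr.
  - move=> z; rewrite normrM ger0_norm ?pt_ge0// ler_wpM2l ?pt_ge0//.
    by rewrite normrM -expr2 powR_mulrn.
  - by apply: le_lt_trans h2 _; rewrite lte_mul_pinfty ?lee_fin ?mulr_ge0 ?powR_ge0.
have e1 : \int[m2]_z (pt t z.1 z.2 * ((u z.1 - u z.2) * (u z.1 - u z.2))) =
    2 * (energy g (s + s) - energy g (s + (t + s))).
  have := kernel_op_increment hp (ler1n _ 2) mu_ uoo bu.
  under eq_Rintegral do rewrite mulrBr.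
  rewrite RintegralB//; last 2 first.
  - by have [] := bounded_integrableM bu (semigroup_bounded_integrable t0 bu).
  - by have [] := bounded_integrableM bu bu.
  rewrite (semigroup_inner s0 s0 bg).
  have -> : \int[mu]_x (u x * P t u x) = energy g (s + (t + s)).
    have ts0 : 0 < t + s by rewrite addr_gt0.
    rewrite -(semigroup_inner s0 ts0 bg); apply: ae_eq_Rintegral.
    - apply: measurable_funM => //; apply: bounded_integrable_measurable.
      exact: semigroup_bounded_integrable.
    - apply: measurable_funM => //; apply: bounded_integrable_measurable.
      exact: semigroup_bounded_integrable.
    - by apply: filterS (semigroup_add hpt t0 s0 bg) => x ->.
  move: (energy g _) (energy g _) (Rintegral m2 _ _) => a b c.
  by rewrite mulNr => /eqP; rewrite subr_eq => /eqP->; field.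
have [ig2 _] := bounded_integrableM bg bg.
have -> : (\int[mu]_x (`|g x| ^+ 2)%:E = (\int[mu]_x (g x * g x))%:E)%E.
  rewrite EFin_Rintegral//; apply: eq_integral => x _.
  by rewrite real_normK ?num_real// expr2.
have -> : (\int[m2]_z (pt t z.1 z.2 * `|u z.1 - u z.2| ^+ 2)%:E =
    (\int[m2]_z (pt t z.1 z.2 * ((u z.1 - u z.2) * (u z.1 - u z.2))))%:E)%E.
  rewrite EFin_Rintegral//; apply: eq_integral => z _.
  by rewrite real_normK ?num_real// expr2.
rewrite e1 -EFinM lee_fin [X in _ <= X]mulrC ler_pdivlMr//.
have := @energy_decrement_le t g (n.*2.+1) t0 bg.
rewrite (_ : n.*2.+2%:R * t = s + s); last first.
  by rewrite /s -[n.*2.+2]/(n.+1).*2 -muln2 natrM; ring.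
rewrite (_ : n.*2.+3%:R * t = s + (t + s)); last first.
  by rewrite /s -natr1 -[n.*2.+2]/(n.+1).*2 -muln2 natrM; ring.
set D := _ - _; have g0 : 0 <= \int[mu]_x (g x * g x).
  by apply: Rintegral_ge0 => x _; rewrite -expr2 sqr_ge0.
have -> : n.*2.+3%:R = 2 * n.+1%:R + 1 :> R.
  by rewrite -natr1 -[n.*2.+2]/(n.+1).*2 -muln2 natrM mulrC.
move: (\int[mu]_x _) D g0 => G D g0.
have [D0|D0] := leP 0 D; first by lra.
move=> _; apply: le_trans g0.
by rewrite -mulrA mulr_ge0_le0// mulr_le0_ge0// ltW.
Qed.

End markov_semigroup.

(** * Weighted Hoelder inequality and duality *)

Lemma ge0_lty_EFin {R : realType} (x : \bar R) :
  (0 <= x)%E -> (x < +oo)%E -> exists2 r : R, 0 <= r & x = r%:E.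
Proof. by case: x => // r; rewrite lee_fin => r0 _; exists r. Qed.

Section weighted_hoelder.
Context {d} {Y : measurableType d} {R : realType}.
Variable nu : {measure set Y -> \bar R}.
Implicit Types (rho W F G : Y -> R) (p q a b : R).

(** Hoelder's inequality for the measure of density [rho], the weight [W]
    being inserted on one factor and removed from the other. *)
Lemma weighted_hoelder rho W F G p q a b : 1 < p -> p^-1 + q^-1 = 1 ->
  measurable_fun setT rho -> measurable_fun setT W ->
  measurable_fun setT F -> measurable_fun setT G ->
  (forall y, 0 <= rho y) -> (forall y, 0 < W y) -> 0 <= a -> 0 <= b ->
  (\int[nu]_y (rho y * (`|F y| `^ p * W y `^ (2 - p)))%:E <= a%:E)%E ->
  (\int[nu]_y (rho y * (`|G y| `^ q * W y `^ (2 - q)))%:E <= b%:E)%E ->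
  (\int[nu]_y (rho y * (`|F y| * `|G y|))%:E <= (a `^ p^-1 * b `^ q^-1)%:E)%E.
Proof.
move=> p1 pq mrho mW mF mG rho0 W0 a0 b0 Fa Gb.
have p0 : 0 < p by rewrite (lt_trans _ p1).
have q0 : 0 < q.
  rewrite -invr_gt0 (_ : q^-1 = 1 - p^-1); last by rewrite -pq addrAC subrr add0r.
  by rewrite subr_gt0 invf_lt1.
pose f (r : R) (H : Y -> R) y : R := rho y `^ r^-1 * (`|H y| * W y `^ ((2 - r) / r)).
have mf r H : measurable_fun setT H -> measurable_fun setT (f r H).
  by move=> mH; rewrite /f; measurability.
have fE r H y : 0 < r ->
    `|f r H y| `^ r = rho y * (`|H y| `^ r * W y `^ (2 - r)).
  move=> r0; rewrite ger0_norm ?mulr_ge0 ?powR_ge0// !powRM ?mulr_ge0 ?powR_ge0//.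
  by rewrite -!powRrM mulVf ?gt_eqF// powRr1// divfK ?gt_eqF.
have := hoelder nu (mf p F mF) (mf q G mG) p0 q0 pq.
rewrite Lnorm1 unlock /=.
under [X in (_ <= X `^ _ * _)%E -> _]eq_integral do rewrite fE//.
under [X in (_ <= _ * X `^ _)%E -> _]eq_integral do rewrite fE//.
have -> : (\int[nu]_y `|(f p F y * f q G y)%:E| =
    \int[nu]_y (rho y * (`|F y| * `|G y|))%:E)%E.
  apply: eq_integral => y _; rewrite abse_EFin ger0_norm; last first.
    by rewrite !mulr_ge0 ?powR_ge0.
  rewrite /f; congr EFin.
  rewrite (_ : _ * _ = rho y `^ p^-1 * rho y `^ q^-1 * (`|F y| * `|G y|) *
      (W y `^ ((2 - p) / p) * W y `^ ((2 - q) / q))); last by ring.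
  rewrite -powRD ?pq ?oner_eq0// powRr1//.
  rewrite -powRD ?(gt_eqF (W0 y)) ?implybT//.
  rewrite (_ : (2 - p) / p + (2 - q) / q = 2 * (p^-1 + q^-1) - 2); last first.
    by field; rewrite !gt_eqF.
  by rewrite pq mulr1 subrr powRr0 mulr1.
move=> /le_trans; apply; rewrite EFinM -!poweR_EFin.
have powR_mono r u v : 0 < r -> (0 <= u <= v)%E -> (u `^ r^-1 <= v `^ r^-1)%E.
  move=> r0 /andP[u0 uv]; apply: gt0_ler_poweR => //.
  - by rewrite invr_ge0 ltW.
  - by rewrite in_itv/= u0 leey.
  - by rewrite in_itv/= (le_trans u0 uv) leey.
have int_ge0 r H : (0 <= \int[nu]_y (rho y * (`|H y| `^ r * W y `^ (2 - r)))%:E)%E.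
  by apply: integral_ge0 => y _; rewrite lee_fin !mulr_ge0 ?powR_ge0.
by apply: lee_pmul; rewrite ?poweR_ge0//; apply: powR_mono; rewrite ?int_ge0.
Qed.

End weighted_hoelder.

Section duality.
Context {d} {T : measurableType d} {R : realType}.
Variable mu : {sigma_finite_measure set T -> \bar R}.
Implicit Types (f g h : T -> R) (p G C : R).

(** The norm of [g] in the dual of [L^p], written with powers of integrals for
    [p > 1] and pointwise for [p = 1]. *)
Definition dual_norm_le p g G : Prop :=
  if p == 1 then forall x, `|g x| <= G
  else (\int[mu]_x (`|g x| `^ (p / (p - 1)))%:E <= (G `^ (p / (p - 1)))%:E)%E.

Let powR_absorb p (I C : R) : 1 < p -> 0 <= I -> 0 <= C ->
  I <= C * I `^ ((p - 1) / p) -> I <= C `^ p.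
Proof.
move=> p1 I0 C0; have p0 : 0 < p by rewrite (lt_trans _ p1).
have pp0 : p != 0 by rewrite gt_eqF.
have [->|I_neq0] := eqVneq I 0; first by rewrite powR_ge0.
have Igt0 : 0 < I by rewrite lt_neqAle eq_sym I_neq0.
rewrite -ler_pdivrMr ?powR_gt0// -powRN -{1}[I](powRr1 I0).
rewrite -powRD ?I_neq0 ?implybT// (_ : 1 + - ((p - 1) / p) = p^-1); last by field.
move=> IC; rewrite -[I](powRr1 I0) -(mulVf pp0) powRrM.
by rewrite ge0_ler_powR ?nnegrE ?powR_ge0// ltW.
Qed.

(** Testing against [sg h * |h| `^ (p - 1)], truncated to a bounded integrable
    function. *)
Lemma Lp_duality p h C : 1 <= p -> 0 <= C -> measurable_fun setT h ->
  (forall g, bounded_integrable mu g -> mu.-integrable setT (EFin \o (h \* g))) ->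
  (forall g G, bounded_integrable mu g -> 0 <= G -> dual_norm_le p g G ->
    `|\int[mu]_x (h x * g x)| <= C * G) ->
  (\int[mu]_x (`|h x| `^ p)%:E <= (C `^ p)%:E)%E.
Proof.
move=> p1 C0 mh ih hC; have p0 : 0 < p by rewrite (lt_le_trans _ p1).
have [F [FT ndF mF]] := (sigma_finiteP setT mu).1 (@sigma_finiteT _ _ _ mu).
pose k := truncation F (fun x => `|h x|).
have mnh : measurable_fun setT (fun x => `|h x|) by measurability.
have bk n : bounded_integrable mu (k n).
  by apply: (bounded_integrable_truncation mF).
have mk n := bounded_integrable_measurable (bk n).
have k0 n x : 0 <= k n x by exact: truncation_ge0.
have mkp n : measurable_fun setT (fun x => k n x `^ p) by measurability.
have main n : (\int[mu]_x (k n x `^ p)%:E <= (C `^ p)%:E)%E.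
  pose sgn x : R := if h x < 0 then -1 else 1.
  have sgn1 x : `|sgn x| = 1 by rewrite /sgn; case: ifP; rewrite ?normrN normr1.
  have hsgn x : h x * sgn x = `|h x|.
    rewrite /sgn; case: ltP => [h0|h0]; first by rewrite mulrN1 ltr0_norm.
    by rewrite mulr1 ger0_norm.
  have msgn : measurable_fun setT sgn.
    by apply: measurable_fun_ifT => //; exact: measurable_fun_ltr.
  (* Off [F n] the truncation vanishes, but for [p = 1] its power does not. *)
  pose c x := k n x `^ (p - 1) * \1_(F n) x.
  have c0 x : 0 <= c x by rewrite mulr_ge0 ?powR_ge0.
  have mF1 : measurable_fun setT (\1_(F n) : T -> R).
    by apply: measurable_indic; have [] := mF n.
  have mc : measurable_fun setT c.
    apply: measurable_funM => //.
    exact: (measurableT_comp (measurable_powR _) (mk n)).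
  pose g x := sgn x * c x.
  have g_norm x : `|g x| = c x by rewrite normrM sgn1 mul1r ger0_norm.
  have mg : measurable_fun setT g by exact: measurable_funM.
  have [M kM] := (bk n).2.
  have bg : bounded_integrable mu g.
    have b1 : bounded_integrable mu (fun x => `|M| `^ (p - 1) * \1_(F n) x).
      have [i1 [N N1]] := bounded_integrable_indic mF n; split; last first.
        exists (`|M| `^ (p - 1) * N) => x.
        by rewrite normrM ger0_norm ?powR_ge0// ler_wpM2l ?powR_ge0.
      exact: (integrableZl measurableT _ i1).
    apply: le_bounded_integrable b1 => // x; rewrite g_norm.
    rewrite [X in _ <= X]ger0_norm ?mulr_ge0 ?powR_ge0//.
    rewrite ler_wpM2r// ge0_ler_powR ?nnegrE ?subr_ge0//.
    by rewrite -[k n x]ger0_norm// (le_trans (kM x))// ler_norm.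
  have [ik _] := bk n.
  have koo := bounded_integrable_powR_lty p1 (bk n).
  have kpE : (\int[mu]_x (`|k n x| `^ p)%:E = \int[mu]_x (k n x `^ p)%:E)%E.
    by apply: eq_integral => x _; rewrite ger0_norm.
  rewrite kpE in koo.
  have int0 : (0 <= \int[mu]_x (k n x `^ p)%:E)%E.
    by apply: integral_ge0 => x _; rewrite lee_fin powR_ge0.
  have [I I0 IE] := ge0_lty_EFin int0 koo; clear koo int0 kpE.
  have hg x : k n x `^ p <= h x * g x.
    rewrite /g mulrA hsgn /c /k /truncation indicE; case: (x \in F n); last first.
      by rewrite mulr0n !mulr0 powR0 ?gt_eqF.
    have m0 : 0 <= Num.min `|h x| n%:R by rewrite le_min normr_ge0/=.
    rewrite mulr1n !mulr1 -[X in X <= _](mulr_powRB1 m0 p0).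
    by rewrite ler_wpM2r ?powR_ge0// ge_min lexx.
  have Ihg : I <= \int[mu]_x (h x * g x).
    rewrite -lee_fin -IE EFin_Rintegral; last exact: ih.
    apply: ge0_integral_mono => // [|x]; last by rewrite powR_ge0.
    exact: measurable_funM.
  have hgC G : 0 <= G -> dual_norm_le p g G -> I <= C * G.
    move=> G0 gG; apply: (le_trans Ihg); apply: le_trans (hC _ _ bg G0 gG).
    exact: ler_norm.
  rewrite IE lee_fin; have [p_eq1|p_neq1] := eqVneq p 1.
    rewrite p_eq1 powRr1// -[X in _ <= X]mulr1; apply: hgC => //.
    rewrite /dual_norm_le p_eq1 eqxx => x.
    by rewrite g_norm /c p_eq1 subrr powRr0 mul1r indicE lern1 leq_b1.
  have p_gt1 : 1 < p by rewrite lt_neqAle eq_sym p_neq1.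
  have pB0 : 0 < p - 1 by rewrite subr_gt0.
  have : I <= C * I `^ ((p - 1) / p).
    apply: hgC; first exact: powR_ge0.
    have eE : (p - 1) / p * (p / (p - 1)) = 1 by field; rewrite !gt_eqF.
    rewrite /dual_norm_le (negbTE p_neq1) -powRrM eE powRr1// -IE; apply: ge0_integral_mono => //.
    - under eq_fun do rewrite g_norm.
      exact: (measurableT_comp (measurable_powR _) mc).
    - move=> x; rewrite g_norm; have := c0 x; rewrite /c => cx0.
      apply: (@le_trans _ _ ((k n x `^ (p - 1)) `^ (p / (p - 1)))).
        rewrite ge0_ler_powR ?nnegrE ?cx0 ?powR_ge0 ?divr_ge0 ?(ltW p0) ?(ltW pB0)//.
        by rewrite ler_piMr ?powR_ge0// indicE lern1 leq_b1.
      by rewrite -powRrM mulrCA divff ?gt_eqF// mulr1.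
  exact: powR_absorb.
rewrite (_ : (\int[mu]_x _ = limn (fun n => \int[mu]_x (k n x `^ p)%:E))%E).
  apply: lime_le.
  - apply: ereal_nondecreasing_is_cvgn => m n mn.
    apply: ge0_integral_mono => // x; first by rewrite powR_ge0.
    rewrite ge0_ler_powR ?nnegrE ?(ltW p0)//.
    exact: le_truncation.
  - exact: nearW.
rewrite -monotone_convergence//.
- apply: eq_integral => x _; apply/esym/lim_near_cst => //.
  have [N hN] := truncation_near FT ndF (fun x => `|h x|) x.
  by exists N => // n /= /hN; rewrite /k => ->.
- by move=> n; exact/measurable_EFinP.
- by move=> n x _; rewrite lee_fin powR_ge0.
- move=> x _ m n mn; rewrite lee_fin ge0_ler_powR ?nnegrE ?(ltW p0)//.
  exact: le_truncation.
Qed.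

End duality.

(** * The pseudo-Poincare inequality of a symmetric Markov semigroup *)

(** The constant of the Marcinkiewicz theorem for the exponent dual to [p]; no
    interpolation takes place at the endpoints [p = 1] and [p = 2]. *)
Definition interpolation_constant {R : realType} (p : R) : R :=
  let e := p / (p - 1) - 2 in
  if (p == 1) || (p == 2) then 1 else
  (4 * 2 `^ e * (2 `^ e / (2 `^ e - 1)) * 2 `^ e) `^ (p / (p - 1))^-1.

Lemma interpolation_constant_ge0 {R : realType} (p : R) :
  0 <= interpolation_constant p.
Proof. by rewrite /interpolation_constant; case: ifP; rewrite ?powR_ge0. Qed.

Section pseudo_poincare.
Context {d} {T : measurableType d} {R : realType}.
Variable mu : {sigma_finite_measure set T -> \bar R}.
Variable pt : R -> T -> T -> R.
Hypothesis hpt : symmetric_markov_semigroup mu pt.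

Local Notation m2 := (mu \x mu)%E.
Local Notation P t := (kernel_op mu (pt t)).

Implicit Types (g h k u : T -> R) (G L c : R).

Variables (p : R) (f : T -> R).
Hypotheses (p12 : 1 <= p <= 2) (mf : measurable_fun setT f).
Hypothesis foo : (\int[mu]_x (`|f x| `^ p)%:E < +oo)%E.

Let p1 : 1 <= p. Proof. by case/andP: p12. Qed.
Let p2 : p <= 2. Proof. by case/andP: p12. Qed.
Let p0 : 0 < p. Proof. exact: lt_le_trans p1. Qed.

Let q := p / (p - 1).

Let q_conj : p != 1 -> p^-1 + q^-1 = 1.
Proof. by move=> pn1; rewrite /q; field; rewrite subr_eq0 pn1 gt_eqF. Qed.

Let q_ge2 : p != 1 -> 2 <= q.
Proof.
move=> pn1; have pB : 0 < p - 1 by rewrite subr_gt0 lt_neqAle eq_sym pn1.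
by rewrite ler_pdivlMr// mulrBr mulr1 lerBlDr mulr_natl mulr2n lerD2l.
Qed.

Let pt_ge0 (t : R) x y : 0 < t -> 0 <= pt t x y.
Proof. by move=> t0; exact: ltW (markov_gt0 (semigroup_kernel hpt t0) x y). Qed.

Let measurable_pt (t : R) : 0 < t ->
  measurable_fun setT (fun z : T * T => pt t z.1 z.2).
Proof. by move=> t0; exact: markov_measurable (semigroup_kernel hpt t0). Qed.

Let measurable_incr g : measurable_fun setT g ->
  measurable_fun setT (fun z : T * T => g z.1 - g z.2).
Proof.
by move=> mg; apply: measurable_funB;
  [exact: (measurableT_comp mg measurable_fst) |
   exact: (measurableT_comp mg measurable_snd)].
Qed.

Let measurable_norm_incr g : measurable_fun setT g ->
  measurable_fun setT (fun z : T * T => `|g z.1 - g z.2|).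
Proof.
move=> mg; apply: (measurableT_comp (@normr_measurable _ setT)).
exact: measurable_incr.
Qed.

Variables (t s v : R).
Hypotheses (t0 : 0 < t) (s0 : 0 < s) (v0 : 0 <= v).
Hypothesis fv :
  (\int[m2]_z (pt s z.1 z.2 * `|f z.1 - f z.2| `^ p)%:E <= v%:E)%E.

Let increment_le u c : bounded_integrable mu u ->
  (\int[m2]_z (pt t z.1 z.2 * (`|f z.1 - f z.2| * `|u z.1 - u z.2|))%:E <=
    c%:E)%E ->
  `|\int[mu]_x (f x * (P t u x - u x))| <= c / 2.
Proof.
move=> bu uc; have mu_ := bounded_integrable_measurable bu.
rewrite (kernel_op_increment (semigroup_kernel hpt t0) p1 mf foo bu).
have h2 : `|- 2^-1| = 2^-1 :> R by rewrite normrN ger0_norm// invr_ge0.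
rewrite normrM h2 mulrC ler_pM2r ?invr_gt0//.
apply: le_norm_Rintegral.
  by apply: measurable_funM; [exact: measurable_pt |
    apply: measurable_funM; exact: measurable_incr].
apply: le_trans uc; rewrite le_eqVlt; apply/orP; left; apply/eqP.
by apply: eq_integral => z _; rewrite !normrM ger0_norm ?pt_ge0.
Qed.

Let weighted_variation_le L (W : T * T -> R) : measurable_fun setT W ->
  0 <= L -> (forall z, 0 < W z) ->
  (forall z, pt t z.1 z.2 * W z `^ (2 - p) <= L * pt s z.1 z.2) ->
  (\int[m2]_z (pt t z.1 z.2 * (`|f z.1 - f z.2| `^ p * W z `^ (2 - p)))%:E <=
    (L * v)%:E)%E.
Proof.
move=> mW L0 W0 hW.
have mfp : measurable_fun setT (fun z : T * T => `|f z.1 - f z.2| `^ p).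
  by apply: (measurableT_comp (measurable_powR _)); exact: measurable_norm_incr.
have msf : measurable_fun setT
    (fun z : T * T => pt s z.1 z.2 * `|f z.1 - f z.2| `^ p).
  by apply: measurable_funM => //; exact: measurable_pt.
apply: (@le_trans _ _ (\int[m2]_z
    (L * (pt s z.1 z.2 * `|f z.1 - f z.2| `^ p))%:E)%E).
  apply: ge0_integral_mono => [||z|z].
  - apply: measurable_funM; first exact: measurable_pt.
    by apply: measurable_funM => //; exact: (measurableT_comp (measurable_powR _)).
  - exact: measurable_funM.
  - by rewrite !mulr_ge0 ?powR_ge0 ?pt_ge0.
  - by rewrite mulrCA mulrC mulrA ler_wpM2r ?powR_ge0.
rewrite ge0_integral_scale//; last first.
  by move=> z; rewrite mulr_ge0 ?powR_ge0 ?pt_ge0.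
by rewrite EFinM lee_wpmul2l ?lee_fin.
Qed.

(* For [p = 1] the dual exponent is infinite, and the increments of [u] are
   bounded pointwise. *)
Let increment_le_p1 L u c : p = 1 -> 0 <= L -> 0 <= c ->
  bounded_integrable mu u ->
  (forall x y, pt t x y * `|u x - u y| <= c * (L * pt s x y)) ->
  `|\int[mu]_x (f x * (P t u x - u x))| <= c * (L * v) / 2.
Proof.
move=> p_eq1 L0 c0 bu hu; have mu_ := bounded_integrable_measurable bu.
apply: increment_le => //.
have mfp : measurable_fun setT (fun z : T * T => `|f z.1 - f z.2| `^ p).
  by apply: (measurableT_comp (measurable_powR _)); exact: measurable_norm_incr.
have msf : measurable_fun setT
    (fun z : T * T => pt s z.1 z.2 * `|f z.1 - f z.2| `^ p).
  by apply: measurable_funM => //; exact: measurable_pt.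
apply: (@le_trans _ _ (\int[m2]_z
    (c * L * (pt s z.1 z.2 * `|f z.1 - f z.2| `^ p))%:E)%E).
  apply: ge0_integral_mono => [||z|z].
  - apply: measurable_funM; first exact: measurable_pt.
    by apply: measurable_funM; exact: measurable_norm_incr.
  - exact: measurable_funM.
  - by rewrite !mulr_ge0 ?pt_ge0.
  - rewrite p_eq1 powRr1// mulrCA mulrC mulrA ler_wpM2r//.
    by rewrite -mulrA.
rewrite ge0_integral_scale ?mulr_ge0//; last first.
  by move=> z; rewrite mulr_ge0 ?powR_ge0 ?pt_ge0.
by rewrite (mulrA c L v) (EFinM _ v) lee_wpmul2l ?lee_fin ?mulr_ge0.
Qed.

Let increment_le_hoelder L (W : T * T -> R) u b : p != 1 -> measurable_fun setT W ->
  0 <= L -> (forall z, 0 < W z) ->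
  (forall z, pt t z.1 z.2 * W z `^ (2 - p) <= L * pt s z.1 z.2) ->
  bounded_integrable mu u -> 0 <= b ->
  (\int[m2]_z (pt t z.1 z.2 * (`|u z.1 - u z.2| `^ q * W z `^ (2 - q)))%:E <=
    b%:E)%E ->
  `|\int[mu]_x (f x * (P t u x - u x))| <= (L * v) `^ p^-1 * b `^ q^-1 / 2.
Proof.
move=> pn1 mW L0 W0 hW bu b0 hb; have mu_ := bounded_integrable_measurable bu.
apply: increment_le => //.
have := @weighted_hoelder _ _ _ m2 (fun z => pt t z.1 z.2) W
  (fun z => f z.1 - f z.2) (fun z => u z.1 - u z.2) p q (L * v) b.
apply=> //.
- by rewrite lt_neqAle eq_sym pn1.
- exact: q_conj.
- exact: measurable_pt.
- exact: measurable_incr.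
- exact: measurable_incr.
- by move=> z; exact: pt_ge0.
- exact: mulr_ge0.
- exact: weighted_variation_le.
Qed.

(** The first increment of the telescoping sum, where the semigroup has not yet
    regularized [g]. *)
Lemma first_increment_le L g G : 0 <= L ->
  (forall x y, pt t x y <= L * pt s x y) ->
  bounded_integrable mu g -> 0 <= G -> dual_norm_le mu p g G ->
  `|\int[mu]_x (f x * (P t g x - g x))| <= 2 * (L * v) `^ p^-1 * G.
Proof.
move=> L0 hL bg G0; have mg := bounded_integrable_measurable bg.
rewrite /dual_norm_le; have [p_eq1 gG|pn1 gG] := eqVneq p 1.
  have G20 : 0 <= 2 * G by rewrite mulr_ge0.
  have := @increment_le_p1 L g (2 * G) p_eq1 L0 G20 bg.
  move=> /(_ _)/le_trans; apply.
    move=> x y; rewrite mulrC ler_pM ?pt_ge0//.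
    by rewrite (le_trans (ler_normB _ _))// mulr_natl mulr2n lerD.
  rewrite p_eq1 invr1 powRr1 ?mulr_ge0//.
  rewrite -subr_ge0 (_ : _ - _ = L * v * G); last by field.
  by rewrite !mulr_ge0.
have q2 := q_ge2 pn1; have q0 : 0 < q by rewrite (lt_le_trans _ q2).
have b0 : 0 <= 2 * 2 `^ q * G `^ q by rewrite !mulr_ge0 ?powR_ge0.
have := @increment_le_hoelder L (cst 1) g _ pn1 _ L0 (fun=> ltr01) _ bg b0.
have W1 (r : R) (z : T * T) : cst 1 z `^ r = 1 :> R by rewrite /cst powR1.
move=> /(_ _ _ _)/le_trans; apply.
- by [].
- by move=> z; rewrite W1 mulr1.
- under eq_integral do rewrite W1 mulr1.
  apply: le_trans (markov_incr_powR_le hpt t0 _ mg) _.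
    by rewrite (le_trans _ q2)// ler1n.
  by rewrite (EFinM _ (G `^ q)) lee_wpmul2l ?lee_fin ?mulr_ge0 ?powR_ge0.
rewrite [X in _ * X / _](_ : _ = 2 `^ q^-1 * (2 * G)); last first.
  rewrite -mulrA -powRM// powRM ?powR_ge0// -powRrM divff ?gt_eqF// powRr1//.
  by rewrite mulr_ge0.
have h2 : 2 `^ q^-1 <= 2 :> R.
  rewrite -[X in _ <= X](powRr1 (ler0n _ 2)) ler_powR ?ler1n//.
  by rewrite invf_le1// (le_trans _ q2)// ler1n.
set X := (L * v) `^ _; set a := 2 `^ _ in h2 *.
rewrite (_ : X * (a * (2 * G)) / 2 = X * G * a); last by field.
by rewrite (_ : 2 * X * G = X * G * 2) ?ler_wpM2l ?mulr_ge0 ?powR_ge0//; ring.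
Qed.

(** The later increments: the squared [L^2] norm of the differences of
    [P (n.+1 * t) g] gains the factor [1 / n.+1], their supremum norm is
    controlled by [w], and interpolation gives the intermediate exponent. *)
Lemma regularized_increment_le L A (w : T -> T -> R) n g G :
  0 < L -> 0 < A -> (forall x y, 0 <= w x y) ->
  (forall x y, w x y `^ (2 - p) * pt t x y <= L * pt s x y) ->
  (forall h M, measurable_fun setT h -> (forall x, `|h x| <= M) ->
    forall x y, `|P (n.+1%:R * t) h x - P (n.+1%:R * t) h y| <=
                A * w x y * M) ->
  bounded_integrable mu g -> 0 <= G -> dual_norm_le mu p g G ->
  `|\int[mu]_x (f x * (P t (P (n.+1%:R * t) g) x - P (n.+1%:R * t) g x))| <=
  interpolation_constant p * (L * v) `^ p^-1 *
    (n.+1%:R^-1 `^ (1 - p^-1) * A `^ (2 / p - 1)) * G.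
Proof.
move=> L0 A0 w0 hw hA bg G0; have mg := bounded_integrable_measurable bg.
have nt0 : 0 < n.+1%:R * t by rewrite mulr_gt0.
have hnt := semigroup_kernel hpt nt0.
have bu := semigroup_bounded_integrable hpt nt0 bg.
rewrite /dual_norm_le /interpolation_constant; have [p_eq1 gG|pn1] := eqVneq p 1.
  have := @increment_le_p1 L (P (n.+1%:R * t) g) (A * G) p_eq1 (ltW L0) _ bu.
  move=> /(_ _ _)/le_trans; apply.
  - by rewrite mulr_ge0// ltW.
  - move=> x y; have := hw x y; rewrite p_eq1 (_ : 2 - 1 = 1); last by ring.
    rewrite powRr1// => hxy.
    apply: (@le_trans _ _ (pt t x y * (A * w x y * G))).
      by rewrite ler_wpM2l ?pt_ge0// hA.
    have -> : pt t x y * (A * w x y * G) = A * G * (w x y * pt t x y) by ring.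
    by rewrite ler_wpM2l// mulr_ge0// ltW.
  - rewrite p_eq1 /= invr1 subrr powRr0 (_ : 2 * 1 - 1 = 1); last by ring.
    rewrite !powRr1 ?mulr_ge0 ?(ltW L0) ?(ltW A0)// !mul1r.
    rewrite -subr_ge0 (_ : _ - _ = L * v * A * G / 2); last by field.
    by rewrite !mulr_ge0 ?invr_ge0 ?(ltW L0) ?(ltW A0).
rewrite /= -/q => gG.
have q2 := q_ge2 pn1; have q0 : 0 < q by rewrite (lt_le_trans _ q2).
have qE : q^-1 = 1 - p^-1 by rewrite -(q_conj pn1) addrAC subrr add0r.
have main K X : 0 < K ->
  X <= (L * v) `^ p^-1 *
    (K * (A `^ (q - 2) * n.+1%:R^-1 * G `^ q)) `^ q^-1 / 2 ->
  X <= K `^ q^-1 * (L * v) `^ p^-1 *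
    (n.+1%:R^-1 `^ (1 - p^-1) * A `^ (2 / p - 1)) * G.
  move=> K0; have n0 : 0 <= n.+1%:R^-1 :> R by rewrite invr_ge0.
  have -> : (K * (A `^ (q - 2) / n.+1%:R * G `^ q)) `^ q^-1 =
      K `^ q^-1 * (A `^ ((q - 2) / q) * n.+1%:R^-1 `^ q^-1 * G).
    rewrite [LHS]powRM ?mulr_ge0 ?powR_ge0 ?(ltW K0)//; congr (_ * _).
    rewrite [LHS]powRM ?mulr_ge0 ?powR_ge0//.
    rewrite [X in X * _]powRM ?powR_ge0// -!powRrM.
    by rewrite divff ?gt_eqF// powRr1.
  rewrite -qE.
  have -> : (q - 2) / q = 2 / p - 1.
    by rewrite mulrBl divff ?gt_eqF// qE; ring.
  set Y := (X in _ <= X -> _); move=> /le_trans; apply.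
  set Z := (X in _ <= X); have -> : Y = Z / 2 by rewrite /Y /Z; ring.
  by rewrite ler_piMr ?invf_le1 ?ler1n// /Z !mulr_ge0 ?powR_ge0.
have [p_eq2|pn2] := eqVneq p 2.
  have qe2 : q = 2 by rewrite /q p_eq2 (_ : 2 - 1 = 1) ?divr1//; ring.
  set X := (X in X <= _); have := main 1 X ltr01.
  rewrite (_ : 1 `^ q^-1 = 1) ?powR1//; apply; rewrite {}/X.
  apply: (@increment_le_hoelder L (cst 1)) => //; first exact: ltW.
  - by move=> z; rewrite /cst powR1 mulr1; have := hw z.1 z.2;
      rewrite p_eq2 subrr powRr0 mul1r.
  - by rewrite !mulr_ge0 ?powR_ge0 ?invr_ge0.
  under eq_integral do rewrite /cst powR1 mulr1 qe2 powR_mulrn//.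
  apply: le_trans (semigroup_form_decay hpt n t0 bg) _.
  rewrite qe2 subrr powRr0 !mul1r EFinM lee_wpmul2l ?lee_fin ?invr_ge0//.
  by move: gG; rewrite -/q qe2; under eq_integral do rewrite powR_mulrn//.
have p_lt2 : 0 < 2 - p by rewrite subr_gt0 lt_neqAle pn2.
have q_gt2 : 2 < q.
  have pB : 0 < p - 1 by rewrite subr_gt0 lt_neqAle eq_sym pn1.
  rewrite ltr_pdivlMr// -subr_gt0 (_ : p - 2 * (p - 1) = 2 - p)//; ring.
pose K := 4 * 2 `^ (q - 2) * (2 `^ (q - 2) / (2 `^ (q - 2) - 1)) * 2 `^ (q - 2).
have K0 : 0 < K.
  rewrite !mulr_gt0 ?powR_gt0// invr_gt0 subr_gt0 powR_gt1 ?ltr1n//.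
  by rewrite subr_gt0.
apply: (main K) => //.
(* [W] dominates [w] and, unlike [w], is measurable and makes the weighted
   variation of [f] at time [t] exactly that at time [s]. *)
pose W (z : T * T) := (L * pt s z.1 z.2 / pt t z.1 z.2) `^ (2 - p)^-1.
have pt_gt0 (r : R) x y : 0 < r -> 0 < pt r x y.
  by move=> r0; exact: markov_gt0 (semigroup_kernel hpt r0) x y.
have W0 z : 0 < W z by rewrite powR_gt0// divr_gt0 ?mulr_gt0 ?pt_gt0.
have WE z : pt t z.1 z.2 * W z `^ (2 - p) = L * pt s z.1 z.2.
  rewrite /W -powRrM mulVf ?gt_eqF// powRr1.
    by rewrite mulrC divfK// gt_eqF ?pt_gt0.
  by rewrite ltW// divr_gt0 ?mulr_gt0 ?pt_gt0.
have wW x y : w x y <= W (x, y).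
  have -> : w x y = (w x y `^ (2 - p)) `^ (2 - p)^-1.
    by rewrite -powRrM divff ?gt_eqF// powRr1.
  rewrite ge0_ler_powR ?nnegrE ?invr_ge0 ?(ltW p_lt2) ?powR_ge0//.
  - by rewrite ltW// divr_gt0 ?mulr_gt0 ?pt_gt0.
  - by rewrite ler_pdivlMr ?pt_gt0.
have mW : measurable_fun setT W.
  apply: (measurableT_comp (measurable_powR _)).
  have -> : (fun z : T * T => L * pt s z.1 z.2 / pt t z.1 z.2) =
      (fun z => L * pt s z.1 z.2 * pt t z.1 z.2 `^ (-1)).
    by apply/funext => z; rewrite powR_inv1 ?pt_ge0.
  apply: measurable_funM; first by apply: measurable_funM => //; exact: measurable_pt.
  by apply: (measurableT_comp (measurable_powR _)); exact: measurable_pt.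
apply: (@increment_le_hoelder L W) => //.
- exact: ltW.
- by move=> z; rewrite WE.
- by rewrite (mulr_ge0 (ltW K0))// !mulr_ge0 ?powR_ge0 ?invr_ge0.
have := @marcinkiewicz _ _ _ _ _ mu m2
  (fun g z => P (n.+1%:R * t) g z.1 - P (n.+1%:R * t) g z.2)
  (fun z => pt t z.1 z.2) W A n.+1%:R^-1.
move=> /(_ _ _ _ _ _ _ _ _ _ _ _ _ q_gt2 bg)/le_trans; apply => //.
- exact: measurable_pt.
- by move=> z; exact: pt_ge0.
- move=> h bh; apply: measurable_incr; apply: (measurable_kernel_op _ (markov_measurable hnt)).
  exact: bounded_integrable_measurable bh.
- move=> h k bh bk z.
  have mh := bounded_integrable_measurable bh.
  have mk := bounded_integrable_measurable bk.
  have [M hM] := bh.2; have [N kN] := bk.2.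
  rewrite !(kernel_opB hnt mh mk hM kN).
  apply: le_trans (ler_normD _ _).
  by rewrite le_eqVlt; apply/orP; left; apply/eqP; congr (`|_|); ring.
- move=> h M bh hM [x y] /=.
  apply: (le_trans (hA h M _ hM x y)); first exact: bounded_integrable_measurable bh.
  have M0 : 0 <= M := le_trans (normr_ge0 _) (hM x).
  by rewrite ler_wpM2r// ler_wpM2l ?wW// ltW.
- by move=> h bh; exact: semigroup_form_decay.
rewrite (_ : _ * (2 * A) `^ _ * _ = K * (A `^ (q - 2) * n.+1%:R^-1)); last first.
  by rewrite (powRM _ (ler0n _ 2) (ltW A0)) /K; ring.
rewrite (mulrA K _ (G `^ q)) (EFinM _ (G `^ q)) lee_wpmul2l//.
by rewrite lee_fin (mulr_ge0 (ltW K0))// mulr_ge0 ?powR_ge0 ?invr_ge0.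
Qed.

End pseudo_poincare.

Section telescoping.
Context {d} {T : measurableType d} {R : realType}.
Variable mu : {sigma_finite_measure set T -> \bar R}.
Variable pt : R -> T -> T -> R.
Hypothesis hpt : symmetric_markov_semigroup mu pt.

Local Notation m2 := (mu \x mu)%E.
Local Notation P t := (kernel_op mu (pt t)).

Variables (p : R) (f : T -> R).
Hypotheses (p12 : 1 <= p <= 2) (mf : measurable_fun setT f).
Hypothesis foo : (\int[mu]_x (`|f x| `^ p)%:E < +oo)%E.

Let p1 : 1 <= p. Proof. by case/andP: p12. Qed.

Implicit Types (g h : T -> R) (t s v L M : R).

Let pair_integrable g : bounded_integrable mu g ->
  mu.-integrable setT (EFin \o (f \* g)).
Proof. by move=> bg; exact: (pairing_integrable p1 mf foo bg). Qed.

Lemma telescoping_le t g c0 (c : nat -> R) N : 0 < t ->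
  bounded_integrable mu g ->
  `|\int[mu]_x (f x * (P t g x - g x))| <= c0 ->
  (forall n, `|\int[mu]_x (f x * (P t (P (n.+1%:R * t) g) x -
                                  P (n.+1%:R * t) g x))| <= c n) ->
  `|\int[mu]_x (f x * (P (N.+1%:R * t) g x - g x))| <=
  c0 + \sum_(n < N) c n.
Proof.
move=> t0 bg hc0 hc; elim: N => [|N IH]; first by rewrite mul1r big_ord0 addr0.
have nt0 n : 0 < n.+1%:R * t by rewrite mulr_gt0.
have bP n := semigroup_bounded_integrable hpt (nt0 n) bg.
have bPP := semigroup_bounded_integrable hpt t0 (bP N).
have iB u k : bounded_integrable mu u -> bounded_integrable mu k ->
    \int[mu]_x (f x * (u x - k x)) =
    \int[mu]_x (f x * u x) - \int[mu]_x (f x * k x).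
  move=> bu bk; under eq_Rintegral do rewrite mulrBr.
  by rewrite RintegralB//; exact: pair_integrable.
have PE : \int[mu]_x (f x * P (N.+2%:R * t) g x) =
    \int[mu]_x (f x * P t (P (N.+1%:R * t) g) x).
  congr fine; apply: ae_eq_integral => //.
  - by apply/measurable_EFinP; apply: measurable_funM => //;
      exact: bounded_integrable_measurable (bP _).
  - by apply/measurable_EFinP; apply: measurable_funM => //;
      exact: bounded_integrable_measurable bPP.
  - apply: filterS (semigroup_add hpt t0 (nt0 N) bg) => x + _.
    by rewrite (_ : t + N.+1%:R * t = N.+2%:R * t) => [->//|]; rewrite -natr1; ring.
rewrite big_ord_recr/= addrA.
have -> : \int[mu]_x (f x * (P (N.+2%:R * t) g x - g x)) =
    \int[mu]_x (f x * (P (N.+1%:R * t) g x - g x)) +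
    \int[mu]_x (f x * (P t (P (N.+1%:R * t) g) x - P (N.+1%:R * t) g x)).
  by rewrite !iB// PE [RHS]addrC addrA subrK.
exact: le_trans (ler_normD _ _) (lerD IH (hc N)).
Qed.

(** The pseudo-Poincare inequality at scale [t], over [N.+1] time steps: by
    duality it is a bound on [f] paired with [P (N.+1 * t) g - g], a telescoping
    sum whose terms are Dirichlet forms at scale [t]. *)
Lemma pseudo_Poincare_le t s v L0 L (w : T -> T -> R) (A : nat -> R) N :
  0 < t -> 0 < s -> 0 <= v ->
  (\int[m2]_z (pt s z.1 z.2 * `|f z.1 - f z.2| `^ p)%:E <= v%:E)%E ->
  0 <= L0 -> (forall x y, pt t x y <= L0 * pt s x y) ->
  0 < L -> (forall x y, w x y `^ (2 - p) * pt t x y <= L * pt s x y) ->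
  (forall x y, 0 <= w x y) -> (forall n, 0 < A n) ->
  (forall n (h : T -> R) M, measurable_fun setT h -> (forall x, `|h x| <= M) ->
    forall x y, `|P (n.+1%:R * t) h x - P (n.+1%:R * t) h y| <=
                A n * w x y * M) ->
  (\int[mu]_x (`|P (N.+1%:R * t) f x - f x| `^ p)%:E <=
   ((2 * (L0 * v) `^ p^-1 + \sum_(n < N) interpolation_constant p *
      (L * v) `^ p^-1 * (n.+1%:R^-1 `^ (1 - p^-1) * A n `^ (2 / p - 1)))
    `^ p)%:E)%E.
Proof.
move=> t0 s0 v0 fv L00 hL0 Lgt0 hL w0 A0 hA.
have nt0 : 0 < N.+1%:R * t by rewrite mulr_gt0.
have hnt := semigroup_kernel hpt nt0.
have c_ge0 n : 0 <= interpolation_constant p *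
      (L * v) `^ p^-1 * (n.+1%:R^-1 `^ (1 - p^-1) * A n `^ (2 / p - 1)).
  by rewrite !mulr_ge0 ?powR_ge0 ?interpolation_constant_ge0.
apply: Lp_duality => //.
- by rewrite addr_ge0 ?sumr_ge0// mulr_ge0 ?powR_ge0.
- apply: measurable_funB => //; exact: (measurable_kernel_op _ (markov_measurable hnt)).
- move=> g bg; have [_ iPfg] := markov_pairing_kernel_op_ae hnt p1 mf foo bg.
  have := integrableB measurableT iPfg (pair_integrable bg).
  by apply: eq_integrable => // x _; rewrite /= mulrBl.
move=> g G bg G0 gG; rewrite (kernel_op_selfadjoint hnt p1 mf foo bg).
have h0 := first_increment_le hpt p12 mf foo t0 s0 v0 fv L00 hL0 bg G0 gG.
have hn n := regularized_increment_le hpt p12 mf foo t0 s0 v0 fv Lgt0 (A0 n)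
  w0 hL (hA n) bg G0 gG.
rewrite mulrDl mulr_suml.
exact: (telescoping_le (c := fun n => _) N t0 bg h0 hn).
Qed.

End telescoping.

(** * Summation over the time steps *)

Section time_steps.
Context {R : realType}.

Lemma powR_inv (a r : R) : 0 <= a -> a^-1 `^ r = (a `^ r)^-1.
Proof. by move=> a0; rewrite -powR_inv1// -powRrM mulN1r powRN. Qed.

Lemma powR_div (a b r : R) : 0 <= a -> 0 <= b ->
  (a / b) `^ r = a `^ r / b `^ r.
Proof. by move=> a0 b0; rewrite powRM ?invr_ge0// powR_inv. Qed.

Variables (p k1 k2 b1 b2 : R).
Hypotheses (p12 : 1 <= p <= 2) (k1b1 : 0 < k1 < b1) (k2b2 : 0 < k2 < b2).

Local Notation al1 := (besov_exponent p k1 b1).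
Local Notation al2 := (besov_exponent p k2 b2).

Let p0 : 0 < p. Proof. by case/andP: p12 => p1 _; rewrite (lt_le_trans _ p1). Qed.

Let pV : 2^-1 <= p^-1 <= 1.
Proof.
case/andP: p12 => p1 p2.
by rewrite lef_pV2 ?posrE// p2 invf_le1.
Qed.

Lemma besov_exponent_itv k b : 0 < k < b -> 0 < besov_exponent p k b <= 1.
Proof.
case/andP=> k0 kb; have b0 := lt_trans k0 kb.
have r0 : 0 < k / b by rewrite divr_gt0.
have r1 : k / b < 1 by rewrite ltr_pdivrMr ?mul1r.
rewrite /besov_exponent mul1r; case/andP: pV.
by move: (k / b) p^-1 r0 r1 => r u r0 r1 u1 u2; apply/andP; split; nra.
Qed.

(** The decay in time of one term of the telescoping sum is the derivative of
    [Psi_p] up to constants. *)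
Lemma besov_exponent_rate x : 0 < x ->
  (x `^ (1 - p^-1))^-1 * (sigma (k1 / b1) (k2 / b2) x)^-1 `^ (2 / p - 1) =
  sigma (al1 - 1) (al2 - 1) x.
Proof.
move=> x0; have xn0 : x != 0 by rewrite gt_eqF.
have E r k b : r = k / b -> (x `^ (1 - p^-1))^-1 * (x `^ r)^-1 `^ (2 / p - 1) =
    x `^ (besov_exponent p k b - 1).
  move=> rE; rewrite powR_inv ?powR_ge0// -powRrM -!powRN -powRD ?xn0 ?implybT// /besov_exponent -rE.
  by congr (_ `^ _); ring.
have [x1|x1] := leP x 1.
  by rewrite !sigma_le1 ?(ltW x0)//; exact: E.
by rewrite !sigma_gt1//; exact: E.
Qed.

(** The terms [n < N] add up to a Riemann sum for the derivative of [Psi_p], the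
    powers of [tau] and of [s] combining to [s `^ (- al1)]. The first term has no
    decay in time and is absorbed because [s] is at most a multiple of [t]. *)
Lemma time_steps_sum_le c C I K0 K1 : 1 <= c -> 0 < C -> 0 <= I -> 0 < K0 ->
  0 < K1 -> exists2 D : R, 0 < D & forall s t v tau N, 0 < s <= 1 ->
    s / (2 * c) <= tau -> N.+1%:R * tau = t -> 0 <= v ->
    2 * (K0 * v) `^ p^-1 +
      \sum_(n < N) I * (K1 * s `^ ((2 - p) * (k1 / b1)) * v) `^ p^-1 *
        (n.+1%:R^-1 `^ (1 - p^-1) *
         (C / sigma (k1 / b1) (k2 / b2) (n.+1%:R * tau)) `^ (2 / p - 1)) <=
    D * sigma al1 al2 t * ((s `^ al1)^-1 * v `^ p^-1).
Proof.
move=> c1 C0 I0 K00 K10.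
have c0 : 0 < 2 * c by rewrite mulr_gt0// (lt_le_trans _ c1).
have c21 : 1 <= 2 * c by lra.
have a1 := besov_exponent_itv k1b1; have a2 := besov_exponent_itv k2b2.
have [a10 _] := andP a1; have [a20 _] := andP a2.
pose D0 := 2 * K0 `^ p^-1 * (2 * c) `^ al1.
pose D1 := I * K1 `^ p^-1 * C `^ (2 / p - 1) * (2 * c) `^ p^-1 *
  (al1^-1 + al2^-1).
have D00 : 0 < D0 by rewrite !mulr_gt0 ?powR_gt0.
have aV0 : 0 <= al1^-1 + al2^-1 by rewrite addr_ge0 ?invr_ge0 ?ltW.
have D10 : 0 <= D1 by rewrite !mulr_ge0 ?powR_ge0.
exists (D0 + D1); first by rewrite ltr_wpDr.
move=> s t v tau N /andP[s0 s1] stau taut v0.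
have sc0 : 0 < s / (2 * c) by rewrite divr_gt0.
have tau0 : 0 < tau := lt_le_trans sc0 stau.
have Nt : N%:R * tau <= t by rewrite -taut ler_wpM2r ?ler_nat// ltW.
have taule : tau <= t by rewrite -taut ler_peMl ?ler1n// ltW.
have V0 : 0 <= v `^ p^-1 by exact: powR_ge0.
have S0 : 0 <= (s `^ al1)^-1 by rewrite invr_ge0 powR_ge0.
rewrite -(mulrA (D0 + D1)) [X in _ <= X]mulrDl; apply: lerD.
  have : 1 <= (2 * c) `^ al1 * sigma al1 al2 t * (s `^ al1)^-1.
    rewrite -ler_pdivrMr ?invr_gt0 ?powR_gt0// div1r invrK.
    rewrite -ler_pdivrMl ?powR_gt0// mulrC.
    apply: (@le_trans _ _ (sigma al1 al2 (s / (2 * c)))); last first.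
      by apply: le_sigma; rewrite ?(ltW a10) ?(ltW a20) ?(ltW sc0)//= (le_trans stau).
    rewrite sigma_le1 ?(ltW sc0)/=; last by rewrite ler_pdivrMr// mul1r (le_trans s1).
    by rewrite powR_div ?(ltW s0) ?(ltW c0).
  move=> x1; rewrite (powRM _ (ltW K00) v0).
  rewrite (_ : D0 * _ = 2 * K0 `^ p^-1 * v `^ p^-1 *
      ((2 * c) `^ al1 * sigma al1 al2 t * (s `^ al1)^-1)); last first.
    by rewrite /D0; move: (sigma _ _ _) (_^-1) => S S'; ring.
  by rewrite mulrA ler_peMr// !mulr_ge0 ?powR_ge0.
have tauE : tau `^ (1 - p^-1) = tau `^ (- p^-1) * tau.
  rewrite -[X in _ * X](powRr1 (ltW tau0)) -powRD ?(gt_eqF tau0) ?implybT//.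
  by rewrite addrC.
have tau_s : tau `^ (- p^-1) <= (2 * c) `^ p^-1 * (s `^ p^-1)^-1.
  apply: (@le_trans _ _ ((s / (2 * c)) `^ (- p^-1))).
    rewrite !powRN lef_pV2 ?posrE ?powR_gt0//.
    by rewrite ge0_ler_powR ?nnegrE ?invr_ge0 ?(ltW p0) ?(ltW sc0) ?(ltW tau0).
  by rewrite powRN powR_div ?(ltW s0) ?(ltW c0)// invf_div.
have termE (n : nat) :
  I * (K1 * s `^ ((2 - p) * (k1 / b1)) * v) `^ p^-1 *
        (n.+1%:R^-1 `^ (1 - p^-1) *
         (C / sigma (k1 / b1) (k2 / b2) (n.+1%:R * tau)) `^ (2 / p - 1)) =
  I * K1 `^ p^-1 * C `^ (2 / p - 1) * s `^ ((2 / p - 1) * (k1 / b1)) *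
   v `^ p^-1 * tau `^ (- p^-1) *
   (sigma (al1 - 1) (al2 - 1) (n.+1%:R * tau) * tau).
  have n0 : 0 < n.+1%:R * tau by rewrite mulr_gt0.
  rewrite -besov_exponent_rate// !powRM ?powR_ge0 ?mulr_ge0 ?powR_ge0 ?(ltW K10)
    ?(ltW C0) ?invr_ge0 ?sigma_ge0 ?(ltW tau0)//.
  rewrite -powRrM (_ : (2 - p) * (k1 / b1) / p = (2 / p - 1) * (k1 / b1)); last first.
    by move: (k1 / b1) => r; field; rewrite gt_eqF.
  have tp0 : tau `^ (1 - p^-1) != 0 by rewrite gt_eqF ?powR_gt0.
  have np0 : (n.+1%:R : R) `^ (1 - p^-1) != 0 by rewrite gt_eqF ?powR_gt0.
  rewrite (powR_inv _ (ler0n _ n.+1)).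
  rewrite (_ : (n.+1%:R `^ (1 - p^-1))^-1 = tau `^ (1 - p^-1) *
    (n.+1%:R `^ (1 - p^-1) * tau `^ (1 - p^-1))^-1); last first.
    by rewrite invfM mulrCA divff ?mulr1.
  by move: ((_ * _)^-1) (_^-1 `^ _) => n' S'; rewrite tauE; ring.
under eq_bigr do rewrite termE.
rewrite -mulr_sumr.
have : 0 <= \sum_(n < N) sigma (al1 - 1) (al2 - 1) (n.+1%:R * tau) * tau.
  by apply: sumr_ge0 => n _; rewrite mulr_ge0 ?sigma_ge0// ltW.
have := sigma_Riemann_sum a1 a2 tau0 Nt; move: (\sum_(_ < _) _) => S SD Sge0.
have sE : (s `^ al1)^-1 = s `^ ((2 / p - 1) * (k1 / b1)) * (s `^ p^-1)^-1.
  rewrite -!powRN -powRD ?(gt_eqF s0) ?implybT// /besov_exponent.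
  by congr (_ `^ _); ring.
rewrite sE (_ : D1 * _ = I * K1 `^ p^-1 * C `^ (2 / p - 1) *
  s `^ ((2 / p - 1) * (k1 / b1)) * v `^ p^-1 *
  ((2 * c) `^ p^-1 * (s `^ p^-1)^-1) * ((al1^-1 + al2^-1) * sigma al1 al2 t)); last first.
  by rewrite /D1; move: (al1^-1 + _) (s `^ p^-1)^-1 (sigma _ _ _) => x y z; ring.
apply: ler_pM => //; first by rewrite !mulr_ge0 ?powR_ge0.
by rewrite ler_wpM2l// !mulr_ge0 ?powR_ge0.
Qed.
End time_steps.

(** * The heat semigroup of a doubling space *)

Lemma sigma_finite_measureP {d} {T : measurableType d} {R : realType}
    (mu : {measure set T -> \bar R}) : sigma_finite setT mu ->
  exists nu : {sigma_finite_measure set T -> \bar R},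
    mu = nu :> {measure set T -> \bar R}.
Proof.
move=> muT.
pose H1 := isSFinite.Build _ _ _ _ (sfinite_measure_sigma_finite muT).
pose H2 := isSigmaFinite.Build _ _ _ _ muT.
pose nu := HB.pack_for (SigmaFiniteMeasure.type T R) (Measure.sort mu) H1 H2.
by exists nu; exact: eq_measure.
Qed.

Section metric_balls.
Context {R : realType} {X : completeMetricType R}.
Variable mu : {measure set (borel X) -> \bar R}.
Hypothesis hmu : doubling mu.

Lemma measurable_metric_ball (x : X) (r : R) :
  measurable (ball x r : set (borel X)).
Proof.
apply: sub_sigma_algebra; rewrite openE => y; rewrite ballEmdist/= => xy.
apply/nbhs_ballP; exists (r - mdist x y); rewrite /= ?subr_gt0// => z.
rewrite !ballEmdist/= ltrBrDl; exact: le_lt_trans (metric_triangle _ _ _).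
Qed.

Lemma doubling_ball_gt0 (x : X) (r : R) : 0 < r -> (0 < mu (ball x r))%E.
Proof.
move=> r0; have [C C0 /(_ x (r / 2))] := hmu.
by rewrite divr_gt0// mulrCA divff// mulr1 => /(_ isT)[].
Qed.

Lemma doubling_sigma_finite : sigma_finite setT mu.
Proof.
exists (fun n => ball (point : X) n.+1%:R).
  apply/esym; rewrite -subTset => x _; exists (Num.bound (mdist (point : X) x)) => //.
  rewrite ballEmdist/= (lt_trans (archi_boundP (mdist_ge0 _ _)))//.
  by rewrite ltr_nat.
move=> n; split; first exact: measurable_metric_ball.
have [C C0 /(_ point n.+1%:R)] := hmu => -[]// _ _.
by move: (mu _) => [r||]//; rewrite ?ltry// mulry gtr0_sg// mul1e.
Qed.

End metric_balls.

Section heat_kernel.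
Context {R : realType} {X : completeMetricType R}.
Variable mu : {sigma_finite_measure set (borel X) -> \bar R}.
Variables (F : set (X -> R)) (E : (X -> R) -> (X -> R) -> R).
Variables (P : R -> (X -> R) -> (X -> R)) (pt : R -> X -> X -> R).
Variables (a1 a2 b1 b2 k1 k2 : R).
Hypothesis hmu : doubling mu.
Hypothesis hP : is_heat_semigroup mu F E P.
Hypothesis hpt : is_heat_kernel mu P pt.
Hypothesis cons : conservative mu pt.
Hypothesis bounds : heat_kernel_bounds pt a1 a2 b1 b2.
Hypotheses (k10 : 0 < k1).
Hypothesis hBE : wBE mu pt b1 b2 k1 k2.

Implicit Types (f g : borel X -> R) (t s M : R).

Lemma bounded_integrable_Lfun2 g : bounded_integrable mu g ->
  g \in Lfun mu 2%:E.
Proof.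
move=> bg; apply/andP; rewrite !inE/=; split.
  exact: bounded_integrable_measurable bg.
rewrite /finite_norm unlock poweR_lty//.
exact: (bounded_integrable_powR_lty (ler1n _ 2) bg).
Qed.

Lemma bounded_Lfun_oo g M : measurable_fun setT g -> (forall x, `|g x| <= M) ->
  g \in Lfun mu +oo%E /\ ('N[mu]_(+oo)[EFin \o g] <= M%:E)%E.
Proof.
move=> mg gM; have M0 : 0 <= M := le_trans (normr_ge0 _) (gM point).
have gN : ('N[mu]_(+oo)[EFin \o g] <= M%:E)%E.
  rewrite unlock; case: ifP => // _.
  by apply/ess_sup_inf.ess_supP; apply: nearW => x /=; rewrite lee_fin.
split=> //; apply/andP; rewrite !inE/=; split => //.
by rewrite /finite_norm (le_lt_trans gN)// ltry.
Qed.

Lemma wBE_bounded : exists2 C : R, 0 < C & forall t g M, 0 < t ->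
  measurable_fun setT g -> (forall x, `|g x| <= M) ->
  forall x y, `|heat mu pt t g x - heat mu pt t g y| <=
    C / sigma (k1 / b1) (k2 / b2) t * sigma k1 k2 (mdist x y) * M.
Proof.
have [C C0 hC] := hBE; exists C => // t g M t0 mg gM x y.
have [gL gN] := bounded_Lfun_oo mg gM.
rewrite -lee_fin; apply: le_trans (hC x y t g t0 gL) _.
rewrite (_ : _ * _ * M = C * (sigma k1 k2 (mdist x y) /
  sigma (k1 / b1) (k2 / b2) t) * M); last by ring.
rewrite [X in (_ <= X)%E]EFinM; apply: lee_wpmul2l => //.
by rewrite lee_fin mulr_ge0 ?divr_ge0 ?sigma_ge0// ltW.
Qed.

(** Conservativeness is an almost everywhere statement; it extends to every point
    because [P_t 1] is continuous by the weak Bakry-Emery condition and every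
    ball has positive measure. *)
Lemma heat_cst1 t x : 0 < t -> heat mu pt t (cst 1) x = 1.
Proof.
move=> t0; have [C C0 hC] := wBE_bounded.
pose C' := C / sigma (k1 / b1) (k2 / b2) t.
have C'0 : 0 < C' by rewrite divr_gt0 ?sigma_gt0.
apply/eqP; rewrite -subr_eq0 -normr_le0; apply/ler_addgt0Pl => e e0.
rewrite addr0.
(* On the ball of radius [r], [C' * sigma k1 k2 d <= C' * r `^ k1 <= e]. *)
pose r := Num.min 1 ((e / C') `^ k1^-1).
have r0 : 0 < r by rewrite lt_min ltr01 powR_gt0// divr_gt0.
have [N [mN N0 Nx]] := cons (ltW t0).
have [y By Ny] : exists2 y, ball x r y & heat mu pt t (cst 1) y = 1.
  apply: contrapT => nB; have := doubling_ball_gt0 hmu x r0.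
  rewrite ltNge => /negP; apply; rewrite -N0; apply: le_measure; rewrite ?inE//.
    exact: measurable_metric_ball.
  by move=> y By; apply: Nx => /= /(_ I) Ny; apply: nB; exists y.
have := hC t (cst 1) 1 t0 (measurable_cst _) _ x y.
rewrite Ny mulr1 => /(_ _)/le_trans; apply => [z|]; first by rewrite normr1.
rewrite -/C' -ler_pdivlMl// mulrC.
have xy : mdist x y <= r by move: By; rewrite ballEmdist => /ltW.
have r1 : r <= 1 by rewrite ge_min lexx.
rewrite sigma_le1 ?mdist_ge0 ?(le_trans xy)//.
apply: (@le_trans _ _ (((e / C') `^ k1^-1) `^ k1)).
  rewrite ge0_ler_powR ?nnegrE ?mdist_ge0 ?powR_ge0 ?(ltW k10)//.
  by rewrite (le_trans xy)// ge_min lexx orbT.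
by rewrite -powRrM mulVf ?gt_eqF// powRr1// divr_ge0 ?(ltW e0) ?(ltW C'0).
Qed.

Lemma heat_kernel_opE t g : 0 < t -> heat mu pt t g = kernel_op mu (pt t) g.
Proof. by move=> t0; apply/funext => x; rewrite /heat t0. Qed.

Let heat_ae t g : 0 < t -> bounded_integrable mu g ->
  P t g = kernel_op mu (pt t) g %[ae mu].
Proof.
by move=> t0 bg; exact: (hk_kernel hpt t0 (bounded_integrable_Lfun2 bg)).
Qed.

Lemma heat_kernel_markov t : 0 < t -> symmetric_markov_kernel mu (pt t).
Proof.
move=> t0; split; first exact: (hk_measurable hpt).
- move=> x y; have [_ [c [C [c0 C0 hl]]]] := bounds.
  apply: lt_le_trans (hl x y t t0); rewrite /sub_gaussian.
  by case: ifP => _; rewrite mulr_gt0 ?divr_gt0 ?sigma_gt0 ?expR_gt0.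
- move=> x; have := heat_cst1 x t0; rewrite heat_kernel_opE// /kernel_op.
  rewrite /Rintegral; under eq_integral do rewrite mulr1.
  by case: (\int[mu]_y _)%E => [r /= ->|/= /eqP|/= /eqP]//;
    rewrite eq_sym oner_eq0.
have aeF : Filter (almost_everywhere mu) by exact: ae_filter_ringOfSetsType.
move=> f g bf bg; have Lf := bounded_integrable_Lfun2 bf.
have Lg := bounded_integrable_Lfun2 bg.
have mP h : bounded_integrable mu h -> measurable_fun setT (P t h : borel X -> R).
  move=> /bounded_integrable_Lfun2 Lh.
  by have /andP[+ _] := hs_L2 hP (ltW t0) Lh; rewrite inE.
have mh h := @bounded_integrable_measurable _ _ _ mu h.
have mK h : bounded_integrable mu h ->
    measurable_fun setT (kernel_op mu (pt t) h).
  by move=> bh; exact: measurable_kernel_op (hk_measurable hpt t0) (mh h bh).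
have EK u v : bounded_integrable mu u -> bounded_integrable mu v ->
    \int[mu]_x (kernel_op mu (pt t) u x * v x) = \int[mu]_x (P t u x * v x).
  move=> bu bv; congr fine; apply: ae_eq_integral => //.
  - by apply/measurable_EFinP; apply: measurable_funM; [exact: mK|exact: mh].
  - by apply/measurable_EFinP; apply: measurable_funM; [exact: mP|exact: mh].
  - by apply: filterS (heat_ae t0 bu) => x ->.
under [RHS]eq_Rintegral do rewrite mulrC.
rewrite !EK//; have := hs_sym hP (ltW t0) Lf Lg; rewrite /inner2 => ->.
by under eq_Rintegral do rewrite mulrC.
Qed.

Lemma heat_kernel_semigroup : symmetric_markov_semigroup mu pt.
Proof.
split; first exact: heat_kernel_markov.
have aeF : Filter (almost_everywhere mu) by exact: ae_filter_ringOfSetsType.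
move=> s t g s0 t0 bg; have Lg := bounded_integrable_Lfun2 bg.
have bPg : bounded_integrable mu (kernel_op mu (pt t) g).
  exact: (bounded_integrable_kernel_op (heat_kernel_markov t0) bg).
have LPg := bounded_integrable_Lfun2 bPg.
have LP := hs_L2 hP (ltW t0) Lg.
have e1 := heat_ae (addr_gt0 s0 t0) bg.
have e2 := hs_add hP (ltW s0) (ltW t0) Lg.
have e3 := hs_ae hP (ltW s0) LP LPg (heat_ae t0 bg).
have e4 := heat_ae s0 bPg.
by apply: filterS2 (filterI e1 e2) (filterI e3 e4) => x [h1 h2] [h3 h4] Dx;
  rewrite -h1// h2// h3// h4.
Qed.

End heat_kernel.

(** * The main inequality *)

Section heat_pseudo_poincare.
Context {R : realType} {X : completeMetricType R}.
Variable mu : {sigma_finite_measure set (borel X) -> \bar R}.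
Variables (F : set (X -> R)) (E : (X -> R) -> (X -> R) -> R).
Variables (P : R -> (X -> R) -> (X -> R)) (pt : R -> X -> X -> R).
Variables (a1 a2 b1 b2 k1 k2 p : R).
Hypothesis hmu : doubling mu.
Hypothesis hP : is_heat_semigroup mu F E P.
Hypothesis hpt : is_heat_kernel mu P pt.
Hypothesis cons : conservative mu pt.
Hypothesis bounds : heat_kernel_bounds pt a1 a2 b1 b2.
Hypotheses (a10 : 0 <= a1) (b12 : 2 <= b1) (b22 : 2 <= b2).
Hypotheses (k1b1 : 0 < k1 < b1) (k2b2 : 0 < k2 < b2).
Hypothesis hBE : wBE mu pt b1 b2 k1 k2.
Hypothesis p12 : 1 <= p <= 2.

Local Notation al1 := (besov_exponent p k1 b1).
Local Notation Psi := (sigma al1 (besov_exponent p k2 b2)).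

Implicit Types (f g : borel X -> R) (t s : R).

Let p1 : 1 <= p. Proof. by case/andP: p12. Qed.
Let p0 : 0 < p. Proof. exact: lt_le_trans p1. Qed.
Let k10 : 0 < k1. Proof. by case/andP: k1b1. Qed.
Let k20 : 0 < k2. Proof. by case/andP: k2b2. Qed.

Let semigroup := heat_kernel_semigroup hmu hP hpt cons bounds k10 hBE.

Lemma heat_variationE f t : measurable_fun setT f -> 0 < t ->
  heat_variation mu pt p f t = ((\int[(mu \x mu)%E]_z
    (pt t z.1 z.2 * `|f z.1 - f z.2| `^ p)%:E) `^ p^-1)%E.
Proof.
move=> mf t0; have mp := hk_measurable hpt t0.
congr (_ `^ _)%E; rewrite (fubini_tonelli1 (fun z : borel X * borel X =>
  (pt t z.1 z.2 * `|f z.1 - f z.2| `^ p)%:E)).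
- apply: eq_integral => y _; apply: eq_integral => x _ /=.
  by rewrite mulrC distrC.
- apply/measurable_EFinP; apply: measurable_funM => //.
  apply: (measurableT_comp (measurable_powR _)).
  apply: (measurableT_comp (@normr_measurable _ setT)).
  by apply: measurable_funB;
    [exact: (measurableT_comp mf measurable_fst) |
     exact: (measurableT_comp mf measurable_snd)].
- move=> z; rewrite lee_fin mulr_ge0 ?powR_ge0// ltW//.
  exact: markov_gt0 (semigroup_kernel semigroup t0) _ _.
Qed.

Lemma Lfun_powR_lty f : f \in Lfun mu p%:E ->
  measurable_fun setT f /\ (\int[mu]_x (`|f x| `^ p)%:E < +oo)%E.
Proof.
move=> /andP[/[!inE]/= mf]; rewrite /finite_norm unlock => foo; split=> //.
exact: (lty_poweRy (invr_neq0 (lt0r_neq0 p0)) foo).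
Qed.

(** The pseudo-Poincare inequality holds at each small scale [s], with the
    interval [[0, t]] divided into steps of length comparable to [s]; the bound
    [r] on [s] brings these steps into the range where kernels at times
    comparable to [s] compare. *)
Lemma heat_pseudo_Poincare : exists2 D : R, 0 < D & forall t, 0 < t ->
  exists2 r : R, 0 < r & forall f s, f \in Lfun mu p%:E -> 0 < s < r ->
  ('N[mu]_(p%:E)[EFin \o (heat mu pt t f \- f)%R] <=
   (D * Psi t)%:E * ((s `^ al1)^-1%:E * heat_variation mu pt p f s))%E.
Proof.
have [[cu [Cu [cu0 Cu0 hu]]] [cl [Cl [cl0 Cl0 hl]]]] := bounds.
have [c c1 hc] := sub_gaussian_rescale a2 a10 b12 b22 k10 k20 cu0 Cu0 cl0 Cl0.
have c0 : 0 < c := lt_le_trans ltr01 c1.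
have p2 : 0 <= 2 - p by rewrite subr_ge0; case/andP: p12.
have [K0 K00 hK0] := hc 0 (lexx 0); have [K1 K10 hK1] := hc (2 - p) p2.
have [C C0 hC] := wBE_bounded hBE.
have [D D0 hD] := time_steps_sum_le p12 k1b1 k2b2 c1 C0
  (interpolation_constant_ge0 p) K00 K10.
exists D => // t t0; exists (Num.min 1 (c * t)).
  by rewrite lt_min ltr01 mulr_gt0.
move=> f s Lf; rewrite lt_min => /and3P[s0 /ltW s1 sct].
have [mf foo] := Lfun_powR_lty Lf.
(* As [c * t / s >= 1], rounding it up to [N.+1] at most doubles it. *)
pose N := Num.truncn (c * t / s); pose tau := t / N.+1%:R.
have ts1 : 1 <= c * t / s by rewrite ler_pdivlMr ?mul1r// ltW.
have /andP[Nle ltN] : N%:R <= c * t / s < N.+1%:R.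
  by apply: truncn_itv; exact: le_trans ts1.
have tau0 : 0 < tau by rewrite divr_gt0.
have tauE : N.+1%:R * tau = t by rewrite mulrCA divff ?mulr1.
have stau : s / (2 * c) <= tau <= s / c.
  apply/andP; split.
    rewrite ler_pdivlMr// mulrAC ler_pdivrMr ?mulr_gt0//.
    rewrite (_ : t * (2 * c) = (2 * (c * t / s)) * s); last first.
      by field; rewrite gt_eqF.
    rewrite mulrC ler_wpM2r ?(ltW s0)// -natr1.
    by rewrite mulr_natl mulr2n lerD.
  rewrite ler_pdivrMr// mulrAC ler_pdivlMr// (mulrC t).
  by rewrite (mulrC s) -ler_pdivrMr// ltW.
rewrite heat_variationE//.
have pt0 x y u : 0 < u -> 0 <= pt u x y.
  by move=> u0; exact: ltW (markov_gt0 (semigroup_kernel semigroup u0) x y).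
have PsiD : 0 < D * Psi t by rewrite mulr_gt0 ?sigma_gt0.
set V := (\int[_]_z _)%E.
have V0 : (0 <= V)%E.
  apply: integral_ge0 => z _; rewrite lee_fin mulr_ge0 ?powR_ge0//.
  exact: pt0.
have sal0 : 0 < (s `^ al1)^-1 by rewrite invr_gt0 powR_gt0.
have [Voo|Voo] := eqVneq V +oo%E.
  rewrite Voo poweRyr ?invr_eq0 ?gt_eqF//.
  by rewrite !gt0_muley ?lte_fin// leey.
have VE : V = (fine V)%:E by rewrite fineK// ge0_fin_numE// lt_neqAle Voo leey.
have v0 : 0 <= fine V by rewrite fine_ge0.
have kernel_le m K x y : (forall s t d : R, 0 < s <= 1 ->
      s / (2 * c) <= t <= s / c -> 0 <= d ->
      sigma k1 k2 d `^ m * sub_gaussian a1 a2 b1 b2 cu Cu t d <=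
      K * s `^ (m * (k1 / b1)) * sub_gaussian a1 a2 b1 b2 cl Cl s d) ->
    0 < K -> sigma k1 k2 (mdist x y) `^ m * pt tau x y <=
    K * s `^ (m * (k1 / b1)) * pt s x y.
  move=> hK Kgt0; apply: (@le_trans _ _ (sigma k1 k2 (mdist x y) `^ m *
      sub_gaussian a1 a2 b1 b2 cu Cu tau (mdist x y))).
    by rewrite ler_wpM2l ?powR_ge0// hu.
  apply: le_trans (hK s tau (mdist x y) _ stau (mdist_ge0 _ _)) _; first by rewrite s0.
  by rewrite ler_wpM2l ?mulr_ge0 ?powR_ge0 ?(ltW Kgt0)// hl.
have hL0 x y : pt tau x y <= K0 * pt s x y.
  by have := kernel_le 0 K0 x y hK0 K00; rewrite powRr0 mul1r mul0r powRr0 mulr1.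
have hA n h M : measurable_fun setT (h : borel X -> R) -> (forall x, `|h x| <= M) ->
    forall x y, `|kernel_op mu (pt (n.+1%:R * tau)) h x -
                  kernel_op mu (pt (n.+1%:R * tau)) h y| <=
    C / sigma (k1 / b1) (k2 / b2) (n.+1%:R * tau) * sigma k1 k2 (mdist x y) * M.
  move=> mh hM x y; rewrite -!heat_kernel_opE ?mulr_gt0//.
  by apply: hC; rewrite ?mulr_gt0.
have A0 n : 0 < C / sigma (k1 / b1) (k2 / b2) (n.+1%:R * tau).
  by rewrite divr_gt0 ?sigma_gt0 ?mulr_gt0.
have VleV : (V <= (fine V)%:E)%E by rewrite -VE.
have L0 : 0 < K1 * s `^ ((2 - p) * (k1 / b1)) by rewrite mulr_gt0 ?powR_gt0.
have := pseudo_Poincare_le semigroup p12 mf foo N tau0 s0 v0 VleV (ltW K00) hL0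
  L0 (fun x y => kernel_le _ _ x y hK1 K10) (fun x y => sigma_ge0 _ _ _) A0 hA.
have := hD s t (fine V) tau N _ _ tauE v0; rewrite s0 s1 => /(_ isT).
case/andP: stau => -> _ /(_ isT).
set S := _ + _ => SD IS.
have S0 : 0 <= S.
  rewrite addr_ge0 ?mulr_ge0 ?powR_ge0// sumr_ge0// => n _.
  by rewrite !mulr_ge0 ?powR_ge0 ?interpolation_constant_ge0.
apply: (@le_trans _ _ S%:E).
  rewrite unlock heat_kernel_opE//.
  apply: (@le_trans _ _ ((S `^ p)%:E `^ p^-1)%E).
    apply: gt0_ler_poweR; first by rewrite invr_ge0 ltW.
    - by rewrite in_itv/= leey andbT integral_ge0// => x _; exact: poweR_ge0.
    - by rewrite in_itv/= leey andbT lee_fin powR_ge0.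
    - by rewrite -tauE; exact: IS.
  by rewrite poweR_EFin -powRrM divff ?gt_eqF// powRr1.
by rewrite VE poweR_EFin -!EFinM lee_fin.
Qed.

End heat_pseudo_poincare.
Theorem proposition3p12 (R : realType) (X : completeMetricType R)
    (mu : {measure set (borel X) -> \bar R})
    (F : set (X -> R)) (E : (X -> R) -> (X -> R) -> R)
    (P : R -> (X -> R) -> (X -> R)) (pt : R -> X -> X -> R)
    (a1 a2 b1 b2 k1 k2 p : R) :
  locally_compact [set: X] ->
  radon mu ->
  doubling mu ->
  is_dirichlet_form mu F E ->
  is_heat_semigroup mu F E P ->
  is_heat_kernel mu P pt ->
  conservative mu pt ->
  1 <= a1 -> 1 <= a2 ->
  volume_growth mu a1 a2 ->
  2 <= b1 <= 1 + a1 -> 2 <= b2 <= 1 + a2 ->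
  heat_kernel_bounds pt a1 a2 b1 b2 ->
  0 < k1 < b1 -> 0 < k2 < b2 ->
  wBE mu pt b1 b2 k1 k2 ->
  1 <= p <= 2 ->
  let Psi := sigma (besov_exponent p k1 b1) (besov_exponent p k2 b2) in
  exists2 C : R, 0 < C &
    forall f : X -> R, besov mu pt p Psi f ->
    forall t : R, 0 <= t ->
      ('N[mu]_(p%:E)[EFin \o (heat mu pt t f \- f)%R] <=
       (C * Psi t)%:E *
       limf_einf (fun tau : R =>
         ((tau `^ besov_exponent p k1 b1)^-1)%:E
           * heat_variation mu pt p f tau) (0 : R)^'+)%E.
Proof.
move=> _ _ hmu _ hP hpt cons a11 _ _ /andP[b12 _] /andP[b22 _] bounds k1b1 k2b2.
have [nu muE] := sigma_finite_measureP (doubling_sigma_finite hmu).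
subst mu => hBE p12 Psi.
have a10 : 0 <= a1 := le_trans ler01 a11.
have [D D0 hD] := heat_pseudo_Poincare hmu hP hpt cons bounds a10 b12 b22
  k1b1 k2b2 hBE p12.
exists D => // f [Lf _] t; rewrite le_eqVlt => /predU1P[<-|t0].
  have -> : Psi 0 = 0.
    rewrite /Psi sigma_le1 ?lexx//= powR0// gt_eqF//.
    by have /andP[] := besov_exponent_itv p12 k1b1.
  rewrite mulr0 mul0e (_ : EFin \o _ = cst 0%E) ?Lnorm0//; last first.
    by apply/funext => x; rewrite /= /heat ltxx subrr.
  by rewrite eqe gt_eqF// (lt_le_trans ltr01)//; case/andP: p12.
have PsiD : 0 < D * Psi t by rewrite mulr_gt0 ?sigma_gt0.
have [r r0 hr] := hD t t0.
rewrite -lee_pdivrMl// limf_einfE.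
apply: (@le_trans _ _ (ereal_inf [set ((s `^ besov_exponent p k1 b1)^-1%:E *
    heat_variation nu pt p f s)%E | s in [set s : R | 0 < s < r]])).
  apply: le_ereal_inf_tmp => _ [s /= sr <-]; rewrite lee_pdivrMl//.
  exact: hr Lf sr.
apply: ereal_sup_ubound; exists [set s : R | 0 < s < r] => //=.
by near=> s; apply/andP; split.
Unshelve. all: by end_near.
Qed.
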